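(* Let $(\Omega^{(\bullet,\bullet)},\kappa)$ be a positive definite Kähler structure, with closed integral with respect to a state $\mathbf{f}$, for a differential $*$-calculus $\Omega^\bullet$ of total degree $2n$ over a $*$-algebra $B$. Let $(\mathcal{F},h_{\mathcal{F}},\overline{\partial}_{\mathcal{F}})$ be a negative Hermitian holomorphic module, and let $\theta\in\mathbb{R}_{>0}$ be such that the Chern connection $\nabla$ of $\mathcal{F}$ satisfies $\nabla^2(f)=\theta\,\mathbf{i}\,\kappa\otimes f$ for all $f\in\mathcal{F}$. If the Dolbeault--Dirac operator $D_{\overline{\partial}_{\mathcal{F}}}$ is diagonalisable, then $\theta$ is a lower bound for the non-zero eigenvalues of $$\Delta_{\overline{\partial}_{\mathcal{F}}}:\Omega^{(0,\bullet)}\otimes_B\mathcal{F}\to\Omega^{(0,\bullet)}\otimes_B\mathcal{F}.$$ Moreover, $\sqrt{\theta}$ is a lower bound for the absolute values of the non-zero eigenvalues of $$D_{\overline{\partial}_{\mathcal{F}}}:\Omega^{(0,\bullet)}\otimes_B\mathcal{F}\to\Omega^{(0,\bullet)}\otimes_B\mathcal{F}.$$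
   Context: Algebras are unital over $\mathbb{C}$; $\mathbf{i}=\sqrt{-1}$. **Calculi.** A differential calculus over $B$ is a dg-algebra $(\Omega^\bullet=\bigoplus_{k\ge0}\Omega^k,\mathrm{d})$ with $\Omega^0=B$, generated as an algebra by $a,\mathrm{d}b$ ($a,b\in B$). It has total degree $m$ if $\Omega^m\ne0$ and $\Omega^k=0$ for $k>m$. It is a $*$-calculus if $B$ is a $*$-algebra whose $*$ extends to a conjugate-linear involution of $\Omega^\bullet$ with $\mathrm{d}(\omega^* )=(\mathrm{d}\omega)^*$ and $(\omega\wedge\nu)^*=(-1)^{kl}\nu^*\wedge\omega^*$ for $\omega\in\Omega^k,\nu\in\Omega^l$. **Complex structures.** A complex structure is an $\mathbb{Z}_{\ge0}^2$-algebra grading $\Omega^\bullet=\bigoplus\Omega^{(a,b)}$ with $\Omega^k=\bigoplus_{a+b=k}\Omega^{(a,b)}$, $(\Omega^{(a,b)})^*=\Omega^{(b,a)}$, and $\mathrm{d}=\partial+\overline{\partial}$ with $\partial,\overline{\partial}$ of degrees $(1,0)$ and $(0,1)$. **Kähler structures.** A Kähler structure on a $*$-calculus of total degree $2n$ is a pair $(\Omega^{(\bullet,\bullet)},\kappa)$ of a complex structure and a central, real ($\kappa^*=\kappa$), closed form $\kappa\in\Omega^{(1,1)}$ such that, for $L(\omega)=\kappa\wedge\omega$, the maps $L^{n-k}:\Omega^k\to\Omega^{2n-k}$ are isomorphisms for $k=0,\dots,n-1$. Let $P^{(a,b)}=\{\alpha\in\Omega^{(a,b)}: L^{n-a-b+1}\alpha=0\}$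 for $a+b\le n$; then $\Omega^\bullet=\bigoplus_{a+b\le n}\bigoplus_{0\le j\le n-a-b}L^jP^{(a,b)}$. The Hodge map $\ast$ is the linear map determined by $\ast(L^j\alpha)=(-1)^{k(k+1)/2}\mathbf{i}^{a-b}\frac{j!}{(n-j-k)!}L^{n-j-k}\alpha$ for $\alpha\in P^{(a,b)}$, $k=a+b$. The metric $g:\Omega^\bullet\times\Omega^\bullet\to B$ is $g(\omega,\nu)=\ast(\omega\wedge\ast(\nu^* ))$ on forms of equal degree and $0$ on forms of different degrees. Put $B_{\ge0}=\{\text{finite sums }\sum\lambda_ib_i^*b_i,\ \lambda_i>0,b_i\in B\}$ and $B_{>0}=B_{\ge0}\setminus\{0\}$. The structure is positive definite if $g(\omega,\omega)\in B_{>0}$ for all non-zero $\omega$. **Integral.** A state is a linear map $\mathbf{f}:B\to\mathbb{C}$ with $\mathbf{f}(b^*b)>0$ for $b\neq0$. The integral is $\int=\mathbf{f}\circ\ast:\Omega^{2n}\to\mathbb{C}$; it is closed if $\int\circ\,\mathrm{d}=0$ on $\Omega^{2n-1}$. **Modules.** A connection on a left $B$-module $\mathcal{F}$ is a linear map $\nabla:\mathcal{F}\to\Omega^1\otimes_B\mathcal{F}$ with $\nabla(bf)=\mathrm{d}b\otimes f+b\nabla f$, extended to $\Omega^\bullet\otimes_B\mathcal{F}$ by $\nabla(\omega\otimes f)=\mathrm{d}\omega\otimes f+(-1)^{|\omega|}\omega\wedge\nabla f$. A $(0,1)$-connection is a connection for $(\Omega^{(0,\bullet)},\overline{\partial})$.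 A holomorphic module is a finitely generated projective left $B$-module $\mathcal{F}$ with a flat $(0,1)$-connection $\overline{\partial}_{\mathcal{F}}$ ($\overline{\partial}_{\mathcal{F}}^2=0$). An Hermitian module is a finitely generated projective left $B$-module $\mathcal{F}$ with a right $B$-module isomorphism $h_{\mathcal{F}}:\overline{\mathcal{F}}\to{}^\vee\mathcal{F}={}_B\mathrm{Hom}(\mathcal{F},B)$ (where $\overline{f}b=\overline{b^*f}$ and $(\phi b)(f)=\phi(f)b$) such that the pairing $h_{\mathcal{F}}(f,k):=h_{\mathcal{F}}(\overline{k})(f)$ satisfies $h_{\mathcal{F}}(f,k)=h_{\mathcal{F}}(k,f)^*$ and $h_{\mathcal{F}}(f,f)\in B_{>0}$ for $f\ne0$. An Hermitian holomorphic module carries both structures. Extend the pairing by $h_{\mathcal{F}}(\omega\otimes f,\nu\otimes k)=\omega\,h_{\mathcal{F}}(f,k)\wedge\nu^*$. The Chern connection is the unique connection $\nabla$ with $\mathrm{d}h_{\mathcal{F}}(f,k)=h_{\mathcal{F}}(\nabla f,1\otimes k)+h_{\mathcal{F}}(1\otimes f,\nabla k)$ whose $(0,1)$-part is $\overline{\partial}_{\mathcal{F}}$; its $(1,0)$-part is denoted $\partial_{\mathcal{F}}$. The module is negative if $\nabla^2(f)=\theta\mathbf{i}\kappa\otimes f$ for all $f\in \mathcal{F}$, for some $\theta\in\mathbb{R}_{>0}$. **Operators.** Set $g_{\mathcal{F}}(\omega\otimes f,\nu\otimes k)=g(\omega\,h_{\mathcal{F}}(f,k),\nu)$ on $\Omega^\bullet\otimes_B\mathcal{F}$;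 then $\langle\cdot,\cdot\rangle_{\mathcal{F}}=\mathbf{f}\circ g_{\mathcal{F}}$ is an inner product. With closed integral, $\partial_{\mathcal{F}},\overline{\partial}_{\mathcal{F}}$ (extended to $\Omega^\bullet\otimes_B\mathcal{F}$) have adjoints for it, denoted $\dagger$. Put $D_{\overline{\partial}_{\mathcal{F}}}=\overline{\partial}_{\mathcal{F}}+\overline{\partial}_{\mathcal{F}}^\dagger$ and $\Delta_{\overline{\partial}_{\mathcal{F}}}=D_{\overline{\partial}_{\mathcal{F}}}^2$; both preserve $\Omega^{(0,\bullet)}\otimes_B\mathcal{F}$. Diagonalisable means that $\Omega^\bullet\otimes_B\mathcal{F}$ is the algebraic direct sum of the eigenspaces. *)

(* Defs.v *)
From HB Require Import structures.
From mathcomp Require Import all_boot all_order all_algebra.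
From mathcomp Require Import generic_quotient.
From mathcomp Require Import boolp classical_sets reals.
From mathcomp Require Import complex.

Set Implicit Arguments.
Unset Strict Implicit.
Unset Printing Implicit Defensive.

Import Order.TTheory GRing.Theory Num.Theory.
Local Open Scope ring_scope.
Local Open Scope complex_scope.

(** ** Direct sums *)

Section DirectSum.
Variables (I : eqType) (V : zmodType) (S : I -> set V).

(* [V] is the internal direct sum of the [S i]; each [S i] is meant to be a
   subgroup, which is not part of the predicate. *)
Definition direct_sum : Prop :=
  (forall v, exists (s : seq I) (u : I -> V),
     [/\ uniq s, forall i, i \in s -> S i (u i) & v = \sum_(i <- s) u i]) /\
  (forall (s : seq I) (u : I -> V), uniq s ->
     (forall i, i \in s -> S i (u i)) -> \sum_(i <- s) u i = 0 ->
     forall i, i \in s -> u i = 0).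

(* The [i]-th component of [v]; unique when [direct_sum] holds. *)
Definition component (i : I) (v : V) : V :=
  xget 0 [set w | S i w /\ exists (s : seq I) (u : I -> V),
    [/\ uniq s, i \notin s, forall j, j \in s -> S j (u j)
      & v = w + \sum_(j <- s) u j]].

End DirectSum.

Definition subspace (K : pzRingType) (V : lmodType K) (S : set V) : Prop :=
  S 0 /\ forall (c : K) (u v : V), S u -> S v -> S (c *: u + v).

(** ** Tensor product *)

(* [A] is a right [B]-module through a ring morphism [iota : B -> A], and the
   tensor product of [A] and [F] over [B] is the quotient of the finite formal
   sums of pairs [(a, f)] by the usual relations.  It is a left [A]-module. *)
Section Tensor.
Variables (B A : nzRingType) (iota : {rmorphism B -> A}) (F : lmodType B).

Inductive tens_rel : seq (A * F) -> seq (A * F) -> Prop :=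
| tens_refl s : tens_rel s s
| tens_sym s t : tens_rel s t -> tens_rel t s
| tens_trans s t u : tens_rel s t -> tens_rel t u -> tens_rel s u
| tens_cat s1 t1 s2 t2 :
    tens_rel s1 t1 -> tens_rel s2 t2 -> tens_rel (s1 ++ s2) (t1 ++ t2)
| tens_comm s t : tens_rel (s ++ t) (t ++ s)
| tens_0l f : tens_rel [:: (0, f)] [::]
| tens_addl a1 a2 f : tens_rel [:: (a1 + a2, f)] [:: (a1, f); (a2, f)]
| tens_addr a f1 f2 : tens_rel [:: (a, f1 + f2)] [:: (a, f1); (a, f2)]
| tens_bal a b f : tens_rel [:: (a * iota b, f)] [:: (a, b *: f)].

Definition tens_relb (s t : seq (A * F)) : bool := `[< tens_rel s t >].

Lemma tens_relb_refl : reflexive tens_relb.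
Proof. by move=> s; apply/asboolP; exact: tens_refl. Qed.

Lemma tens_relb_sym : symmetric tens_relb.
Proof. by move=> s t; apply/asboolP/asboolP; exact: tens_sym. Qed.

Lemma tens_relb_trans : transitive tens_relb.
Proof.
move=> t s u /asboolP st /asboolP tu; apply/asboolP; exact: tens_trans st tu.
Qed.

Canonical tens_equiv :=
  EquivRel tens_relb tens_relb_refl tens_relb_sym tens_relb_trans.

Definition tensor : Type := {eq_quot tens_relb}%qT.
HB.instance Definition _ := Choice.on tensor.

Definition tens_class (s : seq (A * F)) : tensor := \pi_({eq_quot tens_relb})%qT s.
Definition tens_repr (x : tensor) : seq (A * F) :=
  repr (x : {eq_quot tens_relb}%qT).

Lemma tens_reprK x : tens_class (tens_repr x) = x.
Proof. exact: reprK. Qed.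

Lemma tens_classP s t : tens_class s = tens_class t <-> tens_rel s t.
Proof. by split=> [/eqmodP/asboolP|h]; last exact/eqmodP/asboolP. Qed.

Lemma tens_reprP s : tens_rel (tens_repr (tens_class s)) s.
Proof. exact/tens_classP/tens_reprK. Qed.

Definition tens_add (x y : tensor) : tensor :=
  tens_class (tens_repr x ++ tens_repr y).
Definition tens_mul_seq (a : A) (s : seq (A * F)) : seq (A * F) :=
  [seq (a * p.1, p.2) | p <- s].
Definition tens_scale (a : A) (x : tensor) : tensor :=
  tens_class (tens_mul_seq a (tens_repr x)).

Lemma tens_mul_rel a s t :
  tens_rel s t -> tens_rel (tens_mul_seq a s) (tens_mul_seq a t).
Proof.
elim=> {s t}.
- by move=> s; exact: tens_refl.
- by move=> s t _; exact: tens_sym.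
- by move=> s t u _ st _; exact: tens_trans.
- by move=> s1 t1 s2 t2 _ h1 _ h2; rewrite /tens_mul_seq !map_cat; exact: tens_cat.
- by move=> s t; rewrite /tens_mul_seq !map_cat; exact: tens_comm.
- by move=> f; rewrite /tens_mul_seq /= mulr0; exact: tens_0l.
- by move=> a1 a2 f; rewrite /tens_mul_seq /= mulrDr; exact: tens_addl.
- by move=> a1 f1 f2; exact: tens_addr.
- by move=> a1 b f; rewrite /tens_mul_seq /= mulrA; exact: tens_bal.
Qed.

Lemma tens_addE s t : tens_add (tens_class s) (tens_class t) = tens_class (s ++ t).
Proof. by apply/tens_classP; apply: tens_cat; exact: tens_reprP. Qed.

Lemma tens_scaleE a s : tens_scale a (tens_class s) = tens_class (tens_mul_seq a s).
Proof. by apply/tens_classP; apply: tens_mul_rel; exact: tens_reprP. Qed.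

Lemma tens_ind (P : tensor -> Prop) : (forall s, P (tens_class s)) -> forall x, P x.
Proof. by move=> h x; rewrite -(tens_reprK x). Qed.

Lemma tens_addA : associative tens_add.
Proof. by do 3!elim/tens_ind=> ?; rewrite !tens_addE catA. Qed.

Lemma tens_addC : commutative tens_add.
Proof.
by do 2!elim/tens_ind=> ?; rewrite !tens_addE; apply/tens_classP; exact: tens_comm.
Qed.

Lemma tens_add0 : left_id (tens_class [::]) tens_add.
Proof. by elim/tens_ind=> s; rewrite tens_addE. Qed.

Lemma tens_scaleDr a : {morph tens_scale a : x y / tens_add x y}.
Proof.
do 2!elim/tens_ind=> ?.
by rewrite !(tens_addE, tens_scaleE) /tens_mul_seq map_cat.
Qed.

Lemma tens_scaleDl x : {morph tens_scale^~ x : a b / a + b >-> tens_add a b}.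
Proof.
move=> a b; elim/tens_ind: x => s; rewrite !tens_scaleE tens_addE.
elim: s => [|[c f] s /tens_classP IHs]; first by [].
apply/tens_classP => /=; rewrite mulrDl.
apply: (@tens_trans _ ([:: (a * c, f); (b * c, f)] ++
                      (tens_mul_seq a s ++ tens_mul_seq b s))).
  by rewrite -[_ :: tens_mul_seq _ s]cat1s; apply: tens_cat => //; exact: tens_addl.
set u := tens_mul_seq a s; set v := tens_mul_seq b s.
change (tens_rel ([:: (a * c, f)] ++ ([:: (b * c, f)] ++ (u ++ v)))
                 ([:: (a * c, f)] ++ (u ++ ([:: (b * c, f)] ++ v)))).
apply: tens_cat; first exact: tens_refl.
by rewrite !catA; apply: tens_cat; [exact: tens_comm|exact: tens_refl].
Qed.

Lemma tens_scale0 x : tens_scale 0 x = tens_class [::].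
Proof.
elim/tens_ind: x => s; rewrite tens_scaleE.
elim: s => [//|[c f] s /tens_classP IHs]; apply/tens_classP => /=.
rewrite mul0r -cat1s -[[::]]/([::] ++ [::]).
by apply: tens_cat => //; exact: tens_0l.
Qed.

Lemma tens_scale1 : left_id 1 tens_scale.
Proof.
elim/tens_ind=> s; rewrite tens_scaleE /tens_mul_seq.
by congr tens_class; rewrite -[RHS]map_id; apply: eq_map => -[c f] /=; rewrite mul1r.
Qed.

Lemma tens_scaleA a b x : tens_scale a (tens_scale b x) = tens_scale (a * b) x.
Proof.
elim/tens_ind: x => s; rewrite !tens_scaleE /tens_mul_seq -map_comp.
by congr tens_class; apply: eq_map => -[c f] /=; rewrite mulrA.
Qed.

Lemma tens_addN : left_inverse (tens_class [::]) (tens_scale (-1)) tens_add.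
Proof.
by move=> x; rewrite -{2}[x]tens_scale1 -tens_scaleDl addNr tens_scale0.
Qed.

HB.instance Definition _ :=
  GRing.isZmodule.Build tensor tens_addA tens_addC tens_add0 tens_addN.

HB.instance Definition _ := GRing.Zmodule_isLmodule.Build A tensor
  tens_scaleA tens_scale1 tens_scaleDr tens_scaleDl.

Definition tens (a : A) (f : F) : tensor := tens_class [:: (a, f)].

(* The additive map [a (x) f |-> phi a f] on the tensor product.  It is computed
   on a chosen representative, so it is meaningful when [phi] is additive in
   each argument and balanced over [B]; see [tens_lift_tens]. *)
Definition tens_lift (M : zmodType) (phi : A -> F -> M) (x : tensor) : M :=
  \sum_(p <- tens_repr x) phi p.1 p.2.

(* The additive span of the [a (x) f] with [a] in [S]. *)
Definition tens_sub (S : set A) : set tensor :=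
  [set x | exists s : seq (A * F),
     (forall p, p \in s -> S p.1) /\ x = \sum_(p <- s) tens p.1 p.2].

Section Lift.
Variables (M : zmodType) (phi : A -> F -> M).
Hypothesis phiDl : forall a1 a2 f, phi (a1 + a2) f = phi a1 f + phi a2 f.
Hypothesis phiDr : forall a f1 f2, phi a (f1 + f2) = phi a f1 + phi a f2.
Hypothesis phi_bal : forall a b f, phi (a * iota b) f = phi a (b *: f).

Let sum_phi s := \sum_(p <- s) phi p.1 p.2.

Lemma tens_lift_rel s t : tens_rel s t -> sum_phi s = sum_phi t.
Proof.
rewrite /sum_phi; elim=> {s t}.
- by [].
- by move=> s t _ ->.
- by move=> s t u _ -> _ ->.
- by move=> s1 t1 s2 t2 _ h1 _ h2; rewrite !big_cat /= h1 h2.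
- by move=> s t; rewrite !big_cat /= addrC.
- move=> f; rewrite big_seq1 big_nil /=.
  by apply: (@addrI _ (phi 0 f)); rewrite -phiDl !addr0.
- by move=> a1 a2 f; rewrite !big_cons !big_nil /= !addr0 phiDl.
- by move=> a f1 f2; rewrite !big_cons !big_nil /= !addr0 phiDr.
- by move=> a b f; rewrite !big_seq1 /= phi_bal.
Qed.

Lemma tens_liftD : {morph tens_lift phi : x y / x + y}.
Proof.
move=> x y; rewrite /tens_lift -big_cat.
exact: tens_lift_rel (tens_reprP _).
Qed.

Lemma tens_lift_tens a f : tens_lift phi (tens a f) = phi a f.
Proof. by have := tens_lift_rel (tens_reprP [:: (a, f)]); rewrite /sum_phi big_seq1. Qed.

End Lift.
End Tensor.

(** ** Differential calculi *)

Record starAlgebra (R : realType) := StarAlgebra {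
  sa_alg :> algType R[i];
  astar : sa_alg -> sa_alg;
  astarK : involutive astar;
  astarP : forall (c : R[i]) x y, astar (c *: x + y) = c^* *: astar x + astar y;
  astarM : forall x y, astar (x * y) = astar y * astar x
}.

Record calculus (R : realType) (B : algType R[i]) := Calculus {
  calc_alg :> algType R[i];
  incl : {lrmorphism B -> calc_alg};
  form : nat -> set calc_alg;
  dif : {linear calc_alg -> calc_alg};
  incl_inj : injective incl;
  form0P : forall w, form 0 w <-> exists b, incl b = w;
  form_subspace : forall k, subspace (form k);
  form_direct : direct_sum form;
  formM : forall k l v w, form k v -> form l w -> form (k + l)%N (v * w);
  form_dif : forall k w, form k w -> form k.+1 (dif w);
  dif_dif : forall w, dif (dif w) = 0;
  difM : forall k v w, form k v ->
    dif (v * w) = dif v * w + (-1) ^+ k *: (v * dif w);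
  calc_gen : forall S : set calc_alg, subspace S ->
    (forall v w, S v -> S w -> S (v * w)) ->
    (forall b, S (incl b)) -> (forall b, S (dif (incl b))) -> forall w, S w
}.
Arguments incl {R B} _.
Arguments form {R B} _ _ _.
Arguments dif {R B} _.

Definition total_degree (R : realType) (B : algType R[i]) (Om : calculus B)
    (m : nat) : Prop :=
  (exists2 w, form Om m w & w != 0) /\
  (forall k w, (m < k)%N -> form Om k w -> w = 0).

Record starCalculus (R : realType) (B : starAlgebra R) := StarCalculus {
  sc_calc :> calculus B;
  star : sc_calc -> sc_calc;
  starK : involutive star;
  starP : forall (c : R[i]) v w, star (c *: v + w) = c^* *: star v + star w;
  star_incl : forall b, star (incl sc_calc b) = incl sc_calc (astar b);
  star_dif : forall w, dif sc_calc (star w) = star (dif sc_calc w);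
  starM : forall k l v w, form sc_calc k v -> form sc_calc l w ->
    star (v * w) = (-1) ^+ (k * l) *: (star w * star v)
}.
Arguments star {R B} _ _.

(** ** Complex and Kaehler structures *)

Record complexStructure (R : realType) (B : starAlgebra R)
    (Om : starCalculus B) := ComplexStructure {
  bform : nat * nat -> set Om;
  del : {linear Om -> Om};
  delbar : {linear Om -> Om};
  bform_subspace : forall ab, subspace (bform ab);
  bform_direct : direct_sum bform;
  bformM : forall a b a' b' v w, bform (a, b) v -> bform (a', b') w ->
    bform ((a + a')%N, (b + b')%N) (v * w);
  form_bform : forall k w, form Om k w <->
    exists u : nat -> Om, (forall a, (a <= k)%N -> bform (a, (k - a)%N) (u a)) /\
      w = \sum_(a < k.+1) u a;
  star_bform : forall a b w, bform (b, a) (star Om w) <-> bform (a, b) w;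
  dif_split : forall w, dif Om w = del w + delbar w;
  bform_del : forall a b w, bform (a, b) w -> bform (a.+1, b) (del w);
  bform_delbar : forall a b w, bform (a, b) w -> bform (a, b.+1) (delbar w)
}.
Arguments bform {R B Om} _ _ _.
Arguments del {R B Om} _.
Arguments delbar {R B Om} _.

Record kahlerStructure (R : realType) (B : starAlgebra R)
    (Om : starCalculus B) (n : nat) := KahlerStructure {
  ks_complex :> complexStructure Om;
  kappa : Om;
  kappa_total : total_degree Om (2 * n);
  kappa_bform : bform ks_complex (1, 1)%N kappa;
  kappa_central : forall w, kappa * w = w * kappa;
  kappa_real : star Om kappa = kappa;
  kappa_closed : dif Om kappa = 0;
  kappa_lefschetz : forall k, (k < n)%N ->
    forall v, form Om (2 * n - k)%N v ->
    exists! w, form Om k w /\ kappa ^+ (n - k) * w = v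
}.
Arguments kappa {R B Om n} _.

Section Kahler.
Variables (R : realType) (B : starAlgebra R) (Om : starCalculus B) (n : nat).
Variable K : kahlerStructure Om n.

Definition lefschetz (w : Om) : Om := kappa K * w.

Definition primitive (a b : nat) : set Om :=
  [set w | bform K (a, b) w /\ iter (n - (a + b)).+1 lefschetz w = 0].

Definition hodge_coef (a b j : nat) : R[i] :=
  let k := (a + b)%N in
  (-1) ^+ (k * k.+1)./2 * ('i : R[i]) ^ (a%:Z - b%:Z)
    * (j`!%:R / (n - j - k)`!%:R).

Definition is_hodge (s : Om -> Om) : Prop :=
  (forall (c : R[i]) v w, s (c *: v + w) = c *: s v + s w) /\
  (forall a b j w, (a + b <= n)%N -> (j <= n - (a + b))%N -> primitive a b w ->
     s (iter j lefschetz w) =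
       hodge_coef a b j *: iter (n - j - (a + b)) lefschetz w).

(* The Lefschetz decomposition of [Om] makes the map in [is_hodge] exist and be
   unique. *)
Definition hodge : Om -> Om := xget (fun=> 0) [set s | is_hodge s].

(* The inverse of [incl Om : B -> Omega^0]. *)
Definition degree0 (w : Om) : B := xget 0 [set b | incl Om b = w].

Definition metric (v w : Om) : B :=
  \sum_(k < (2 * n).+1)
    degree0 (hodge (component (form Om) k v
                    * hodge (star Om (component (form Om) k w)))).

Definition cone_ge0 : set B :=
  [set x | exists s : seq (R * B), all (fun p => 0 < p.1) s /\
     x = \sum_(p <- s) p.1%:C *: (astar p.2 * p.2)].

Definition cone_gt0 : set B := [set x | cone_ge0 x /\ x != 0].

Definition positive_definite : Prop := forall w : Om, w != 0 -> cone_gt0 (metric w w).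

Section State.
Variable f : {scalar B}.

Definition state : Prop := forall b : B, b != 0 -> 0 < f (astar b * b).

Definition integral (w : Om) : R[i] := f (degree0 (hodge w)).

Definition closed_integral : Prop :=
  forall k w, k.+1 = (2 * n)%N -> form Om k w -> integral (dif Om w) = 0.

End State.

(** ** Modules *)

Section Modules.
Variable F : lmodType B.

Local Notation T := (tensor (incl Om) F).

(* A finitely generated projective module is a direct summand of some [B^m]. *)
Definition fg_projective : Prop :=
  exists (m : nat) (s : {linear F -> 'rV[B]_m}) (p : {linear 'rV[B]_m -> F}),
    cancel s p.

(* [h x y] is [h_F (conj y) (x)].  [herm_right] is the right [B]-linearity of
   [h_F]; the last two clauses say that
   [conj y |-> h_F (conj y)] is a bijection onto the left dual of [F]. *)
Record hermitian_pairing (h : F -> F -> B) : Prop := HermitianPairing {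
  herm_fgp : fg_projective;
  herm_linear : forall (b : B) x x' y, h (b *: x + x') y = b * h x y + h x' y;
  herm_add : forall x y y', h x (y + y') = h x y + h x y';
  herm_right : forall (b : B) x y, h x (astar b *: y) = h x y * b;
  herm_sym : forall x y, h x y = astar (h y x);
  herm_pos : forall x, x != 0 -> cone_gt0 (h x x);
  herm_inj : forall y y', (forall x, h x y = h x y') -> y = y';
  herm_surj : forall phi : {linear F -> B^o}, exists y, forall x, phi x = h x y
}.

(* A connection on [F] for the derivation [delta], whose values on degree zero
   forms lie in [S]. Complex scalars act through the units of [B] and [Om]. *)
Definition connection (delta : Om -> Om) (S : set Om) (D : F -> T) : Prop :=
  [/\ forall x, tens_sub S (D x),
      forall (c : R[i]) x y, D ((c%:A : B) *: x + y) = (c%:A : Om) *: D x + D y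
    & forall (b : B) x,
        D (b *: x) = tens (incl Om) (delta (incl Om b)) x + incl Om b *: D x].

(* [w |-> (-1)^|w| w] *)
Definition grade_sign (w : Om) : Om :=
  \sum_(k < (2 * n).+1) (-1) ^+ k *: component (form Om) k w.

Definition extend (delta : Om -> Om) (D : F -> T) : T -> T :=
  tens_lift (fun w x => tens (incl Om) (delta w) x + grade_sign w *: D x).

Definition holomorphic (dbar : F -> T) : Prop :=
  [/\ fg_projective, connection (delbar K) (bform K (0, 1)%N) dbar
    & forall x, extend (delbar K) dbar (dbar x) = 0].

Section Hermitian.
Variable h : F -> F -> B.

Definition form_pairing (s t : T) : Om :=
  tens_lift (fun v x => tens_lift (fun w y =>
    v * incl Om (h x y) * star Om w) t) s.

Definition chern (dbar nabla : F -> T) : Prop :=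
  [/\ connection (dif Om) (form Om 1) nabla,
      forall x y, dif Om (incl Om (h x y)) =
        form_pairing (nabla x) (tens (incl Om) 1 y)
        + form_pairing (tens (incl Om) 1 x) (nabla y)
    & (* the (0,1)-part of [nabla] is [dbar] *)
      forall x, tens_sub (bform K (1, 0)%N) (nabla x - dbar x)].

Definition metricF (s t : T) : B :=
  tens_lift (fun v x => tens_lift (fun w y =>
    metric (v * incl Om (h x y)) w) t) s.

Variable f : {scalar B}.

Definition inner (s t : T) : R[i] := f (metricF s t).

(* Unique, when it exists, because [inner] is non-degenerate. *)
Definition adjoint (A : T -> T) (t : T) : T :=
  xget 0 [set t' | forall s, inner (A s) t = inner s t'].

Definition dirac (dbar : F -> T) (t : T) : T :=
  extend (delbar K) dbar t + adjoint (extend (delbar K) dbar) t.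

Definition laplacian (dbar : F -> T) (t : T) : T := dirac dbar (dirac dbar t).

End Hermitian.

(* The tensor product of [F] with the sum of the [Omega^(0, b)], as a subgroup of
   [T]: that sum is a direct summand of [Om] as a [B]-bimodule. *)
Definition antiholomorphic_forms : set T :=
  tens_sub [set w | exists b, bform K (0, b)%N w].

Definition eigenspace (A : T -> T) (c : R[i]) : set T :=
  [set t | A t = (c%:A : Om) *: t].

Definition diagonalisable (A : T -> T) : Prop := direct_sum (eigenspace A).

Definition eigenvalue_on (S : set T) (A : T -> T) (c : R[i]) : Prop :=
  exists t, [/\ S t, t != 0 & eigenspace A c t].

End Modules.
End Kahler.

(* Main.v *)
Require Import Defs.
From mathcomp Require Import all_boot all_order all_algebra.
From mathcomp Require Import boolp classical_sets reals.
From mathcomp Require Import complex.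
From mathcomp Require Import zify ring lra.

Set Implicit Arguments.
Unset Strict Implicit.
Unset Printing Implicit Defensive.

Import Defs Order.TTheory GRing.Theory Num.Theory.
Local Open Scope ring_scope.
Local Open Scope complex_scope.

(** The bound is an Akizuki-Nakano inequality in bidegrees (0,k).  There every form
    is primitive, so that the inner product of two twisted (0,k)-forms [s], [t] is a
    constant times the integral of [h(s, t) kappa^m], where [k + m = n] and [h(s, t)]
    is [form_pairing] ([inner_antiholomorphic]).  The Hodge map and the metric
    therefore disappear behind Stokes' theorem ([stokes_form_pairing]) and the
    vanishing of bidegrees with an entry above [n] ([bform_gt_eq0]).

    Let [t] be a twisted (0,k)-form and [p] the (1,0)-part of its covariant
    derivative.  The Lefschetz decomposition reads [p = alpha + kappa beta] with
    [alpha] primitive and [beta] of bidegree (0,k-1) ([lefschetz_split]).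
    - Stokes' theorem gives the Kaehler identity which says that the adjoint of the
      antiholomorphic differential sends [t] to [-i (m + 1) beta]
      ([inner_delbar_contraction]); in particular that adjoint exists.
    - Stokes' theorem applied to [h(t, nabla t)], together with the curvature
      equation, expresses [|alpha|^2] through the norms of [t], of its
      antiholomorphic derivative and of [beta].  Since [|alpha|^2 >= 0], this yields
      [theta (n - k) |t|^2 <= |dbar t|^2 + |dbar^+ t|^2] ([akizuki_nakano]).

    The right-hand side is the inner product of the Laplacian of [t] with [t], so for
    [k < n] an eigenvalue on (0,k)-forms is at least [theta].  For [k = n] the
    inequality says nothing; but if [t] is an eigenvector with non-zero eigenvalue, then
    [dbar^+ t] is a non-zero eigenvector in degree [n - 1] with the same eigenvalue
    ([laplacian_gap_homogeneous]).  A general eigenvector is the sum of its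
    components of bidegree (0,k), which are orthogonal and preserved by the
    Laplacian.  The Dirac operator squares to the Laplacian, which gives the second
    bound. *)

(** * Subspaces and components of a direct sum *)

Section Subspace.
Variables (K : pzRingType) (V : lmodType K) (S : set V).
Hypothesis Ssub : subspace S.

Lemma subspace0 : S 0. Proof. by case: Ssub. Qed.

Lemma subspaceD u v : S u -> S v -> S (u + v).
Proof. by case: Ssub => _ h Su Sv; rewrite -[u]scale1r; apply: h. Qed.

Lemma subspaceZ c u : S u -> S (c *: u).
Proof. by case: Ssub => S0 h Su; rewrite -[_ *: _]addr0; apply: h. Qed.

Lemma subspaceN u : S u -> S (- u).
Proof. by move=> Su; rewrite -scaleN1r; apply: subspaceZ. Qed.

Lemma subspaceB u v : S u -> S v -> S (u - v).
Proof. by move=> Su Sv; apply: subspaceD => //; apply: subspaceN. Qed.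

End Subspace.

Section Component.
Variables (K : pzRingType) (V : lmodType K) (I : eqType) (S : I -> set V).
Hypothesis Ssub : forall i, subspace (S i).
Hypothesis Sdir : direct_sum S.

(** The summands are indexed by a possibly infinite type, so the finite support is
    carried along; extending the family by zero outside it lets two decompositions be
    compared over a common support. *)
Lemma component_split i v : exists (w : V) (s : seq I) (u : I -> V),
  [/\ S i w, uniq s, i \notin s,
      (forall j, S j (u j) /\ (j \notin s -> u j = 0))
    & v = w + \sum_(j <- s) u j].
Proof.
have [s [u [us Su ->]]] := Sdir.1 v.
pose u' j := if j \in rem i s then u j else 0.
exists (if i \in s then u i else 0), (rem i s), u'; split.
- by case: ifP => [/Su//|_]; apply: (subspace0 (Ssub _)).
- exact: rem_uniq.
- by rewrite mem_rem_uniq // inE eqxx.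
- move=> j; rewrite /u'; split; last by move/negPf->.
  by case: ifP => [/mem_rem/Su//|_]; exact: (subspace0 (Ssub _)).
have -> : \sum_(j <- rem i s) u' j = \sum_(j <- rem i s) u j.
  by apply: eq_big_seq => j; rewrite /u' => ->.
case: ifP => [is_|/negbT is_]; last by rewrite rem_id // add0r.
by rewrite (perm_big _ (perm_to_rem is_)) big_cons.
Qed.

Let sum_support (s s' : seq I) (u : I -> V) : uniq s -> uniq s' ->
  (forall j, j \in s -> j \in s') -> (forall j, j \notin s -> u j = 0) ->
  \sum_(j <- s) u j = \sum_(j <- s') u j.
Proof.
move=> us us' sub u0.
rewrite [RHS](bigID (mem s)) /= [X in _ + X]big1 ?addr0 => [|j /u0 //].
rewrite -[RHS]big_filter; apply: perm_big; apply: uniq_perm => //.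
  exact: filter_uniq.
by move=> j; rewrite mem_filter; apply/idP/andP => [h|[]//]; split=> //; apply: sub.
Qed.

Lemma component_unique i v w (s : seq I) (u : I -> V) :
  S i w -> uniq s -> i \notin s -> (forall j, j \in s -> S j (u j)) ->
  v = w + \sum_(j <- s) u j -> component S i v = w.
Proof.
move=> Sw us is_ Su vE; rewrite /component.
apply: xget_unique; first by split=> //; exists s, u; split.
move=> w' [Sw' [s' [u' [us' is' Su' vE']]]].
pose ext (r : seq I) (x : I -> V) j := if j \in r then x j else 0.
have extE r x : \sum_(j <- r) x j = \sum_(j <- r) ext r x j.
  by apply: eq_big_seq => j; rewrite /ext => ->.
have ext0 r x j : j \notin r -> ext r x j = 0 by rewrite /ext => /negPf->.
have Sext r x j : (forall j, j \in r -> S j (x j)) -> S j (ext r x j).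
  by move=> h; rewrite /ext; case: ifP => [/h//|_]; apply: (subspace0 (Ssub _)).
pose t := undup (s ++ s').
have ut : uniq t by apply: undup_uniq.
have it : i \notin t by rewrite mem_undup mem_cat negb_or is_.
have Es : \sum_(j <- s) u j = \sum_(j <- t) ext s u j.
  rewrite extE; apply: sum_support => // [j js|j]; last exact: ext0.
  by rewrite mem_undup mem_cat js.
have Es' : \sum_(j <- s') u' j = \sum_(j <- t) ext s' u' j.
  rewrite extE; apply: sum_support => // [j js|j]; last exact: ext0.
  by rewrite mem_undup mem_cat js orbT.
pose x j := if j == i then w' - w else ext s' u' j - ext s u j.
have := Sdir.2 (i :: t) x; rewrite /= it ut => /(_ isT) h.
apply/eqP; rewrite -subr_eq0; apply/eqP.
have -> : w' - w = x i by rewrite /x eqxx.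
apply: h; rewrite ?inE ?eqxx //.
  move=> j _; rewrite /x; case: eqP => [->|_]; first exact: subspaceB.
  by apply: subspaceB => //; apply: Sext.
rewrite big_cons {1}/x eqxx.
have -> : \sum_(j <- t) x j = \sum_(j <- t) (ext s' u' j - ext s u j).
  by apply: eq_big_seq => j jt; rewrite /x; case: eqP it jt => [->/negPf->|].
rewrite sumrB -Es -Es' addrACA -vE' -opprD -vE subrr //.
Qed.

Lemma componentP i v : S i (component S i v).
Proof.
have [w [s [u [Sw us is_ Su vE]]]] := component_split i v.
by rewrite (component_unique Sw us is_ _ vE) // => j _; apply: (Su j).1.
Qed.

Lemma component_linear i c v v' :
  component S i (c *: v + v') = c *: component S i v + component S i v'.
Proof.
have [w [s [u [Sw us is_ Su vE]]]] := component_split i v.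
have [w' [s' [u' [Sw' us' is' Su' vE']]]] := component_split i v'.
rewrite (component_unique Sw us is_ (fun j _ => (Su j).1) vE).
rewrite (component_unique Sw' us' is' (fun j _ => (Su' j).1) vE').
pose t := undup (s ++ s').
apply: (@component_unique _ _ _ t (fun j => c *: u j + u' j)).
- by apply: subspaceD => //; apply: subspaceZ.
- exact: undup_uniq.
- by rewrite mem_undup mem_cat negb_or is_.
- move=> j _; apply: subspaceD => //; last exact: (Su' j).1.
  by apply: subspaceZ => //; apply: (Su j).1.
rewrite big_split /= -scaler_sumr vE vE' scalerDr addrACA.
rewrite (@sum_support s t) ?(@sum_support s' t) ?undup_uniq // => j jt;
  by [apply: (Su j).2 | apply: (Su' j).2 | rewrite mem_undup mem_cat jt ?orbT].
Qed.

Lemma component_id i v : S i v -> component S i v = v.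
Proof.
by move=> Sv; apply: (@component_unique _ _ _ [::] (fun=> 0)); rewrite ?big_nil ?addr0.
Qed.

Lemma component_other i j v : S j v -> i != j -> component S i v = 0.
Proof.
move=> Sv ij; apply: (@component_unique _ _ _ [:: j] (fun=> v)).
- exact: subspace0.
- by [].
- by rewrite inE.
- by move=> k; rewrite inE => /eqP->.
by rewrite big_seq1 add0r.
Qed.

Lemma component0 i : component S i 0 = 0.
Proof. by apply: component_id; apply: subspace0. Qed.

Lemma componentD i v v' :
  component S i (v + v') = component S i v + component S i v'.
Proof. by rewrite -[v]scale1r component_linear !scale1r. Qed.

Lemma component_sum i (J : Type) (r : seq J) (P : pred J) (x : J -> V) :
  component S i (\sum_(j <- r | P j) x j) = \sum_(j <- r | P j) component S i (x j).
Proof.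
by apply: (big_morph _ (componentD i)); apply: component0.
Qed.

Lemma direct_sum_ind (P : V -> Prop) : P 0 ->
  (forall v w, P v -> P w -> P (v + w)) -> (forall i v, S i v -> P v) ->
  forall v, P v.
Proof.
move=> P0 PD PS v; have [s [u [_ Su ->]]] := Sdir.1 v.
by rewrite big_seq; elim/big_ind: _ => // i /Su; apply: PS.
Qed.

End Component.

(** * Degrees and bidegrees of forms *)

Section StarCalculus.
Variables (R : realType) (B : starAlgebra R) (Om : starCalculus B).

Local Notation fcomp := (component (form Om)).
Local Notation inc := (incl Om).
Implicit Types (v w : Om) (b : B) (c : R[i]).

Let fsub := form_subspace Om.
Let fdir := form_direct Om.

Lemma star0 : star Om 0 = 0.
Proof.
have := starP (s := Om) (-1) 0 0; rewrite scaler0 addr0 rmorphN rmorph1 scaleN1r.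
by rewrite addNr.
Qed.

Lemma starD v w : star Om (v + w) = star Om v + star Om w.
Proof. by rewrite -[v]scale1r starP rmorph1 !scale1r. Qed.

Lemma starZ c v : star Om (c *: v) = c^* *: star Om v.
Proof. by rewrite -[c *: v]addr0 starP star0 addr0. Qed.

Lemma star1 : star Om 1 = 1.
Proof.
rewrite -(rmorph1 inc) star_incl -[astar 1]mul1r -{1}(astarK (1 : B)) -astarM.
by rewrite mul1r astarK.
Qed.

Lemma form_incl b : form Om 0 (inc b).
Proof. by apply/form0P; exists b. Qed.

Lemma form_ind (P : Om -> Prop) : P 0 -> (forall v w, P v -> P w -> P (v + w)) ->
  (forall k v, form Om k v -> P v) -> forall v, P v.
Proof. exact: direct_sum_ind fdir P. Qed.

Lemma star_inclMr b w : star Om (w * inc b) = inc (astar b) * star Om w.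
Proof.
elim/form_ind: w => [|v w hv hw|k w fw]; first by rewrite mul0r star0 mulr0.
- by rewrite mulrDl !starD hv hw mulrDr.
by rewrite (starM fw (form_incl b)) muln0 scale1r star_incl.
Qed.

Lemma fcomp_inclMr k b w : fcomp k (w * inc b) = fcomp k w * inc b.
Proof.
elim/form_ind: w => [|v w hv hw|l w fw].
- by rewrite mul0r (component0 fsub fdir) mul0r.
- by rewrite mulrDl !(componentD fsub fdir) hv hw mulrDl.
have fw' : form Om l (w * inc b) by have := formM fw (form_incl b); rewrite addn0.
case: (eqVneq k l) => [->|kl]; first by rewrite !(component_id fsub fdir).
by rewrite !(component_other fsub fdir _ kl) ?mul0r.
Qed.

Lemma graded_derivation1 (delta : Om -> Om) :
  (forall k v w, form Om k v ->
    delta (v * w) = delta v * w + (-1) ^+ k *: (v * delta w)) ->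
  delta 1 = 0.
Proof.
move=> /(_ 0%N _ 1 (form_incl 1)).
rewrite rmorph1 expr0 scale1r !mul1r mulr1 => /eqP; rewrite -subr_eq0 opprD addrA subrr.
by rewrite sub0r oppr_eq0 => /eqP.
Qed.

End StarCalculus.

Section ComplexStructure.
Variables (R : realType) (B : starAlgebra R) (Om : starCalculus B).
Variable K : complexStructure Om.

Local Notation bcomp := (component (bform K)).
Local Notation inc := (incl Om).
Implicit Types (v w : Om) (b : B) (c : R[i]).

Let bsub := bform_subspace K.
Let bdir := bform_direct K.

Lemma bform_form p q w : bform K (p, q) w -> form Om (p + q) w.
Proof.
move=> hw; apply/(form_bform K); exists (fun a => if a == p then w else 0); split.
  move=> a _; case: eqP => [->|_]; last exact: (subspace0 (bsub _)).
  by rewrite addKn.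
have hp : (p < (p + q).+1)%N by lia.
by rewrite (bigD1 (Ordinal hp)) //= eqxx big1 ?addr0 // => i /negPf; rewrite -val_eqE /= => ->.
Qed.

Lemma bform_ind (P : Om -> Prop) : P 0 -> (forall v w, P v -> P w -> P (v + w)) ->
  (forall p q v, bform K (p, q) v -> P v) -> forall v, P v.
Proof. by move=> P0 PD PS; apply: (direct_sum_ind bdir P0 PD) => -[]. Qed.

Lemma form_bform_ind k (P : Om -> Prop) : P 0 -> (forall v w, P v -> P w -> P (v + w)) ->
  (forall p q v, (p + q)%N = k -> bform K (p, q) v -> P v) ->
  forall v, form Om k v -> P v.
Proof.
move=> P0 PD PS v /(form_bform K) [u [hu ->]].
elim/big_ind: _ => // -[a ha] _ /=; apply: (PS a (k - a)%N); last exact: hu.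
by rewrite subnKC.
Qed.

Lemma bform_incl b : bform K (0, 0)%N (inc b).
Proof.
have /(form_bform K) [u [hu ->]] := form_incl Om b.
by rewrite big_ord1; apply: hu.
Qed.

Lemma bform_inclMl b pq w : bform K pq w -> bform K pq (inc b * w).
Proof. by case: pq => p q hw; have := bformM (bform_incl b) hw. Qed.

Lemma bform_inclMr b pq w : bform K pq w -> bform K pq (w * inc b).
Proof. by case: pq => p q hw; have := bformM hw (bform_incl b); rewrite !addn0. Qed.

Lemma bform_star p q w : bform K (p, q) w -> bform K (q, p) (star Om w).
Proof. by move/(star_bform K). Qed.

Lemma bform_add_eq0 pq pq' v w :
  bform K pq v -> bform K pq' w -> pq != pq' -> v + w = 0 -> v = 0.
Proof.
move=> hv hw ne vw.
have := congr1 (bcomp pq) vw.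
rewrite (componentD bsub bdir) (component0 bsub bdir) (component_id bsub bdir hv).
by rewrite (component_other bsub bdir hw ne) addr0.
Qed.

(** In the Leibniz rule of [dif], both sides split into parts of two different
    bidegrees, and the parts must agree separately. *)
Lemma delbarM k v w : form Om k v ->
  delbar K (v * w) = delbar K v * w + (-1) ^+ k *: (v * delbar K w).
Proof.
move=> fv; move: v fv w; apply: form_bform_ind => [w|v v' hv hv' w|p q v pqk hv].
- by rewrite !(mul0r, linear0, scaler0, addr0).
- by rewrite !(mulrDl, linearD) /= hv hv' ?scalerDr addrACA.
elim/bform_ind => [|w w' hw hw'|p' q' w hw].
- by rewrite !(mulr0, linear0, scaler0, addr0).
- by rewrite !(mulrDr, linearD) /= hw hw' ?scalerDr addrACA.
have := difM w (bform_form hv); rewrite !(dif_split K) pqk => /eqP.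
rewrite -subr_eq0 => /eqP e; apply/eqP; rewrite -subr_eq0; apply/eqP.
pose X := del K (v * w) - (del K v * w + (-1) ^+ k *: (v * del K w)).
pose Y := delbar K (v * w) - (delbar K v * w + (-1) ^+ k *: (v * delbar K w)).
have hX : bform K ((p + p').+1, q + q')%N X.
  apply: subspaceB => //; first by apply: bform_del; apply: bformM.
  apply: subspaceD => //; first by have := bformM (bform_del hv) hw.
  by apply: subspaceZ => //; have := bformM hv (bform_del hw); rewrite addnS.
have hY : bform K (p + p', (q + q').+1)%N Y.
  apply: subspaceB => //; first by apply: bform_delbar; apply: bformM.
  apply: subspaceD => //; first by have := bformM (bform_delbar hv) hw.
  by apply: subspaceZ => //; have := bformM hv (bform_delbar hw); rewrite addnS.
apply: (bform_add_eq0 hY hX); first by rewrite xpair_eqE; lia.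
rewrite -[RHS]e /X /Y mulrDl mulrDr scalerDr.
rewrite addrACA -opprD [delbar K (v * w) + _]addrC; congr (_ - _).
by rewrite addrACA [delbar K v * w + _]addrC [X in _ + X]addrC.
Qed.

Lemma delbar_delbar w : delbar K (delbar K w) = 0.
Proof.
elim/bform_ind: w => [|v w hv hw|p q w hw]; first by rewrite !linear0.
  by rewrite !linearD /= hv hw addr0.
have := dif_dif w; rewrite !(dif_split K) !linearD /= => e.
have h1 := bform_del (bform_del hw); have h2 := bform_delbar (bform_del hw).
have h3 := bform_del (bform_delbar hw); have h4 := bform_delbar (bform_delbar hw).
have := congr1 (bcomp (p, q.+2)) e.
rewrite !(componentD bsub bdir) (component0 bsub bdir) (component_id bsub bdir h4).
rewrite (component_other bsub bdir h1) ?(component_other bsub bdir h2);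
  rewrite ?(component_other bsub bdir h3) ?add0r //; rewrite xpair_eqE; lia.
Qed.

End ComplexStructure.

(** * The Lefschetz operator *)

Section Lefschetz.
Variables (R : realType) (B : starAlgebra R) (Om : starCalculus B) (n : nat).
Variable K : kahlerStructure Om n.

Local Notation bcomp := (component (bform K)).
Local Notation inc := (incl Om).
Local Notation kap := (kappa K).
Implicit Types (v w : Om) (b : B) (c : R[i]).

Let fsub := form_subspace Om.
Let fdir := form_direct Om.
Let bsub := bform_subspace K.
Let bdir := bform_direct K.

Lemma iter_lefschetz j w : iter j (lefschetz K) w = kap ^+ j * w.
Proof.
by elim: j => [|j IH]; rewrite ?mul1r //= IH /lefschetz mulrA exprS.
Qed.

Lemma kappaX_comm m w : kap ^+ m * w = w * kap ^+ m.
Proof. by apply/esym/commrX; rewrite /GRing.comm kappa_central. Qed.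

Lemma kappaX_bform m : bform K (m, m) (kap ^+ m).
Proof.
elim: m => [|m IH]; first by rewrite expr0 -(rmorph1 inc); apply: bform_incl.
by rewrite exprS; have := bformM (kappa_bform K) IH.
Qed.

Lemma bform_kappaM m p q w : bform K (p, q) w -> bform K (p + m, q + m)%N (kap ^+ m * w).
Proof. by rewrite kappaX_comm => hw; apply: bformM => //; apply: kappaX_bform. Qed.

Lemma star_kappaX m : star Om (kap ^+ m) = kap ^+ m.
Proof.
have fk j : form Om (j + j) (kap ^+ j) by apply: bform_form (kappaX_bform j).
elim: m => [|m IH]; first by rewrite expr0 star1.
rewrite exprSr (starM (fk m) (fk 1%N)) IH kappa_real -exprS.
by rewrite -signr_odd oddM (addnn 1) odd_double andbF scale1r -exprSr.
Qed.

Lemma star_kappaM m w : star Om (kap ^+ m * w) = kap ^+ m * star Om w.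
Proof.
elim/form_ind: w => [|v w hv hw|l w fw]; first by rewrite mulr0 star0 mulr0.
  by rewrite mulrDr !starD hv hw mulrDr.
rewrite (starM (bform_form (kappaX_bform m)) fw) star_kappaX kappaX_comm.
by rewrite -signr_odd oddM addnn odd_double /= scale1r.
Qed.

Lemma dif_kappaX m : dif Om (kap ^+ m) = 0.
Proof.
elim: m => [|m IH]; first by rewrite expr0 (graded_derivation1 (difM (c := Om))).
by rewrite exprS (difM _ (bform_form (kappa_bform K))) IH kappa_closed mul0r mulr0
  scaler0 addr0.
Qed.

Lemma dif_kappaM m w : dif Om (w * kap ^+ m) = dif Om w * kap ^+ m.
Proof.
elim/form_ind: w => [|v w hv hw|l w fw].
- by rewrite mul0r linear0 mul0r.
- by rewrite mulrDl !linearD /= hv hw mulrDl.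
by rewrite (difM _ fw) dif_kappaX mulr0 scaler0 addr0.
Qed.

Lemma form_gt_eq0 k w : form Om k w -> (2 * n < k)%N -> w = 0.
Proof. by move=> fw kn; apply: (kappa_total K).2 fw. Qed.

Lemma lefschetz_form m v : (m <= n)%N -> form Om (n + m) v ->
  exists2 u, form Om (n - m) u & kap ^+ m * u = v.
Proof.
case: (posnP m) => [->|m0] mn fv; first by exists v; rewrite ?subn0 ?mul1r // -[n]addn0.
have [] := @kappa_lefschetz _ _ _ _ K (n - m) _ v; first by lia.
  by have -> : (2 * n - (n - m) = n + m)%N by lia.
by move=> u [[fu eu] _]; exists u => //; rewrite -[in LHS](_ : (n - (n - m) = m)%N) //; lia.
Qed.

(** The powers of the Lefschetz operator shift the bidegree along the diagonal, so
    surjectivity in total degree splits into surjectivity in each bidegree.  The form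
    is zero when the source bidegree would have a negative entry. *)
Lemma lefschetz_bform m p q v : (p + q)%N = (n + m)%N -> bform K (p, q) v ->
  v = 0 \/ [/\ (m <= p)%N, (m <= q)%N
             & exists2 u, bform K (p - m, q - m)%N u & kap ^+ m * u = v].
Proof.
move=> pq hv.
have fv : form Om (n + m) v by rewrite -pq; apply: bform_form hv.
case: (leqP m n) => mn; last by left; apply: form_gt_eq0 fv _; lia.
have [u /(form_bform K) [x [hx ->]] uE] := lefschetz_form mn fv.
have {}uE : v = \sum_(a < (n - m).+1) bcomp (p, q) (kap ^+ m * x a).
  rewrite -(component_id bsub bdir hv) -uE mulr_sumr.
  by rewrite (component_sum bsub bdir).
have ne a : (a <= n - m)%N -> (a + m)%N != p -> bcomp (p, q) (kap ^+ m * x a) = 0.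
  move=> ha ne; have := bform_kappaM m (hx _ ha).
  by move/(component_other bsub bdir); apply; rewrite xpair_eqE; lia.
case: (leqP m p) => mp; last first.
  left; rewrite uE big1 // => -[a ha] _; apply: ne; rewrite /= ?ltnS //; lia.
case: (leqP m q) => mq; last first.
  left; rewrite uE big1 // => -[a ha] _; apply: ne; rewrite /= ?ltnS //; lia.
right; split=> //; exists (x (p - m)%N).
  have -> : (q - m = n - m - (p - m))%N by lia.
  by apply: hx; lia.
have hpm : (p - m < (n - m).+1)%N by lia.
rewrite uE (bigD1 (Ordinal hpm)) //= big1 ?addr0 => [|[a ha]].
  apply/esym; apply: (component_id bsub bdir).
  have := @bform_kappaM m (p - m) (n - m - (p - m)) (x (p - m)%N).
  have -> : (p - m + m = p)%N by lia.
  have -> : (n - m - (p - m) + m = q)%N by lia.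
  by apply; apply: hx; lia.
by rewrite -val_eqE /= => apm; apply: ne; lia.
Qed.

(** A bidegree with an entry above [n] would have to be reached from a bidegree with
    a negative entry. *)
Lemma bform_gt_eq0 p q w : bform K (p, q) w -> (n < p)%N || (n < q)%N -> w = 0.
Proof.
move=> hw pq; case: (leqP n (p + q)) => npq; last by lia.
have e : (p + q = n + (p + q - n))%N by lia.
by case: (lefschetz_bform e hw) => // -[]; lia.
Qed.

Lemma primitive_bform p q w : primitive K p q w -> bform K (p, q) w.
Proof. by case. Qed.

Lemma primitiveE p q w :
  primitive K p q w <-> bform K (p, q) w /\ kap ^+ (n - (p + q)).+1 * w = 0.
Proof. by rewrite -iter_lefschetz. Qed.

Lemma primitive_star p q w : primitive K p q w -> primitive K q p (star Om w).
Proof.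
move=> /primitiveE [hw w0]; apply/primitiveE; split; first exact: bform_star.
by rewrite addnC -star_kappaM w0 star0.
Qed.

Lemma primitive_inclMl b p q w : primitive K p q w -> primitive K p q (inc b * w).
Proof.
move=> /primitiveE [hw w0]; apply/primitiveE; split; first exact: bform_inclMl.
by rewrite kappaX_comm -mulrA -kappaX_comm w0 mulr0.
Qed.

(** The contraction of a (0,k)-form would have bidegree (-1,k-1). *)
Lemma antiholomorphic_primitive k w : (k <= n)%N -> bform K (0, k)%N w ->
  primitive K 0 k w.
Proof.
move=> kn hw; apply/primitiveE; split=> //.
apply: (bform_gt_eq0 (bform_kappaM _ hw)); lia.
Qed.

(** Every form is a sum of terms [kappa^j w] with [w] primitive; the existence part
    of the Lefschetz decomposition is used in this inductive form.  In degree at most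
    [n] one subtracts [kappa u], where [u] solves
    [kappa^(N + 2) u = kappa^(N + 1) w] with [N = n - p - q], to get a primitive
    remainder; forms of higher degree are powers of [kappa] times lower ones. *)
Lemma lefschetz_ind (P : nat -> nat -> Om -> Prop) :
  (forall p q, P p q 0) ->
  (forall p q v w, P p q v -> P p q w -> P p q (v + w)) ->
  (forall p q j w, primitive K p q w -> (p + q + j <= n)%N ->
     P (p + j)%N (q + j)%N (kap ^+ j * w)) ->
  forall p q w, bform K (p, q) w -> P p q w.
Proof.
move=> P0 PD PL.
(* The extra factor [kap ^+ m] makes the claim stable under [w |-> kap * u]. *)
have key p : forall q m w, bform K (p, q) w -> (p + q + m <= n)%N ->
    P (p + m)%N (q + m)%N (kap ^+ m * w).
  elim: p => [|p IH] q m w hw hpqm.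
    by apply: PL => //; apply: antiholomorphic_primitive => //; lia.
  pose N := (n - (p.+1 + q))%N.
  have e : (p.+1 + N.+1 + (q + N.+1) = n + N.+2)%N by rewrite /N; lia.
  case: (lefschetz_bform e (bform_kappaM N.+1 hw)) => [w0|[h1 h2 [u]]].
    by apply: PL => //; apply/primitiveE.
  have -> : (p.+1 + N.+1 - N.+2 = p)%N by lia.
  case: q hw hpqm @N e h1 h2 => [|q] hw hpqm N e h1 h2; first by lia.
  have -> : (q.+1 + N.+1 - N.+2 = q)%N by lia.
  move=> hu uE; rewrite -[w](subrK (kap * u)) mulrDr; apply: PD.
    apply: PL => //; apply/primitiveE; split.
      apply: subspaceB => //; rewrite -[kap]expr1.
      by have := bform_kappaM 1 hu; rewrite !addn1.
    by rewrite -/N mulrBr mulrA -exprSr uE subrr.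
  rewrite mulrA -exprSr !addSnnS; apply: IH => //; lia.
move=> p q w hw; case: (leqP (p + q) n) => pqn.
  by have := key p q 0%N w hw; rewrite !addn0 mul1r; apply.
have e : (p + q = n + (p + q - n))%N by lia.
set m := (p + q - n)%N in e; case: (lefschetz_bform e hw) => [->//|[mp mq [u hu <-]]].
by have := key _ _ m u hu; rewrite !subnK //; apply; lia.
Qed.

End Lefschetz.

(** * The Hodge map and the metric *)

Section Hodge.
Variables (R : realType) (B : starAlgebra R) (Om : starCalculus B) (n : nat).
Variable K : kahlerStructure Om n.
Hypothesis Kpos : positive_definite K.

Local Notation inc := (incl Om).
Local Notation kap := (kappa K).
Local Notation star := (star Om).
Local Notation hodge := (hodge K).
Local Notation deg0 := (@degree0 _ _ Om).
Implicit Types (v w : Om) (b : B) (c : R[i]).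

Let fsub := form_subspace Om.
Let fdir := form_direct Om.
Let bsub := bform_subspace K.
Let bdir := bform_direct K.

Lemma degree0_incl b : deg0 (inc b) = b.
Proof. by apply: xget_unique => // b' /incl_inj. Qed.

Lemma degree0_linear c v w : form Om 0 v -> form Om 0 w ->
  deg0 (c *: v + w) = c *: deg0 v + deg0 w.
Proof.
move=> /form0P [b <-] /form0P [b' <-].
by rewrite -linearZ -linearD /= !degree0_incl.
Qed.

(** Without a linear map satisfying the defining formula, [hodge] would be its default
    value, the zero map, and the metric would vanish.  Positivity thus replaces the
    uniqueness part of the Lefschetz decomposition. *)
Lemma hodgeP : is_hodge K hodge.
Proof.
have [hs|nhs] := pselect (exists s, is_hodge K s).
  exact: (xgetPex (fun=> 0) hs).
have h0 : hodge = fun=> 0.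
  by apply: xgetPN => s hs; apply: nhs; exists s.
have [_ /eqP[]] := Kpos (oner_neq0 Om); rewrite /metric big1 // => k _.
by rewrite h0 -(rmorph0 inc) degree0_incl.
Qed.

Lemma hodge_linear c v w : hodge (c *: v + w) = c *: hodge v + hodge w.
Proof. exact: hodgeP.1. Qed.

Lemma hodge0 : hodge 0 = 0.
Proof.
have := hodge_linear (-1) 0 0; rewrite scaler0 addr0 scaleN1r addNr //.
Qed.

Lemma hodgeD v w : hodge (v + w) = hodge v + hodge w.
Proof. by rewrite -[v]scale1r hodge_linear !scale1r. Qed.

Lemma hodge_primitive p q j w : primitive K p q w -> (p + q + j <= n)%N ->
  hodge (kap ^+ j * w) = hodge_coef R n p q j *: (kap ^+ (n - j - (p + q)) * w).
Proof.
move=> hw pqj; rewrite -!iter_lefschetz; apply: hodgeP.2 => //; lia.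
Qed.

Lemma hodge_form k w : form Om k w -> form Om (2 * n - k) (hodge w).
Proof.
move: w; apply: (form_bform_ind (K := K)) => [|v w hv hw|p q w <- hw].
- by rewrite hodge0; apply: (subspace0 (fsub _)).
- by rewrite hodgeD; apply: subspaceD.
apply: (lefschetz_ind (P := fun p q w => form Om (2 * n - (p + q)) (hodge w))) hw
  => [{}p {}q|{}p {}q v {}w hv hw|{}p {}q j {}w hw pqj].
- by rewrite hodge0; apply: (subspace0 (fsub _)).
- by rewrite hodgeD; apply: subspaceD.
rewrite (hodge_primitive hw pqj); apply: subspaceZ => //.
have := bform_form (bform_kappaM (n - j - (p + q)) (primitive_bform hw)).
by congr (form _ _ _); lia.
Qed.

(** Multiplication by [B] preserves primitive forms and commutes with [kappa].  This
    is what makes the metric balanced over [B], hence extendable to tensors. *)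
Lemma hodge_inclMl b w : hodge (inc b * w) = inc b * hodge w.
Proof.
elim/(bform_ind (K := K)): w => [|v w hv hw|p q w hw].
- by rewrite mulr0 hodge0 mulr0.
- by rewrite mulrDr !hodgeD hv hw mulrDr.
apply: (lefschetz_ind (P := fun p q w => hodge (inc b * w) = inc b * hodge w)) hw
  => [{}p {}q|{}p {}q v {}w hv hw|{}p {}q j {}w hw pqj].
- by rewrite mulr0 hodge0 mulr0.
- by rewrite mulrDr !hodgeD hv hw mulrDr.
rewrite mulrA -kappaX_comm -mulrA (hodge_primitive hw pqj).
rewrite (hodge_primitive (primitive_inclMl b hw) pqj).
by rewrite -scalerAr !mulrA -[inc b * _]kappaX_comm.
Qed.

Definition vol w : B := deg0 (hodge w).

Let hodge_top w : form Om (2 * n) w -> form Om 0 (hodge w).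
Proof. by move/hodge_form; rewrite subnn. Qed.

Lemma vol_linear c v w : form Om (2 * n) v -> form Om (2 * n) w ->
  vol (c *: v + w) = c *: vol v + vol w.
Proof. by move=> fv fw; rewrite /vol hodge_linear degree0_linear //; apply: hodge_top. Qed.

Lemma vol0 : vol 0 = 0.
Proof. by rewrite /vol hodge0 -(rmorph0 inc) degree0_incl. Qed.

Lemma volD v w : form Om (2 * n) v -> form Om (2 * n) w -> vol (v + w) = vol v + vol w.
Proof. by move=> fv fw; rewrite -[v]scale1r vol_linear // !scale1r. Qed.

Lemma volZ c v : form Om (2 * n) v -> vol (c *: v) = c *: vol v.
Proof.
by move=> fv; rewrite -[c *: v]addr0 vol_linear ?vol0 ?addr0 //; apply: (subspace0 (fsub _)).
Qed.

Lemma star_form k w : form Om k w -> form Om k (star w).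
Proof.
move: w; apply: (form_bform_ind (K := K)) => [|v w hv hw|p q w <- hw].
- by rewrite star0; apply: (subspace0 (fsub _)).
- by rewrite starD; apply: subspaceD.
by rewrite addnC; apply: bform_form (bform_star hw).
Qed.

Let form_top k v w : (k <= 2 * n)%N -> form Om k v -> form Om k w ->
  form Om (2 * n) (v * hodge (star w)).
Proof.
move=> kn fv fw; have := formM fv (hodge_form (star_form fw)).
by congr (form _ _ _); lia.
Qed.

Lemma metric_linearl c v v' w : metric K (c *: v + v') w = c *: metric K v w + metric K v' w.
Proof.
rewrite /metric scaler_sumr -big_split /=; apply: eq_bigr => -[k hk] _ /=.
have kn : (k <= 2 * n)%N by [].
rewrite (component_linear fsub fdir) mulrDl -scalerAl.
by apply: vol_linear; apply: (form_top kn); apply: componentP.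
Qed.

Lemma metric_linearr c v w w' :
  metric K v (c *: w + w') = c^* *: metric K v w + metric K v w'.
Proof.
rewrite /metric scaler_sumr -big_split /=; apply: eq_bigr => -[k hk] _ /=.
have kn : (k <= 2 * n)%N by [].
rewrite (component_linear fsub fdir) starD starZ hodge_linear mulrDr -scalerAr.
by apply: vol_linear; apply: (form_top kn); apply: componentP.
Qed.

Lemma metric_incl b v w : metric K (v * inc b) w = metric K v (w * inc (astar b)).
Proof.
rewrite /metric; apply: eq_bigr => k _.
by rewrite !fcomp_inclMr star_inclMr astarK hodge_inclMl mulrA.
Qed.

Lemma metric_neq_degree k l v w : form Om k v -> form Om l w -> k != l ->
  metric K v w = 0.
Proof.
move=> fv fw kl; apply: big1 => -[i hi] _ /=.
case: (eqVneq i k) => [ik|ik].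
  rewrite (component_other fsub fdir fw) ?ik // star0 hodge0 mulr0; exact: vol0.
by rewrite (component_other fsub fdir fv) // mul0r; exact: vol0.
Qed.

(** The Hodge dual of the primitive form [star w] is a multiple of
    [kappa^(n - k) * star w]. *)
Lemma metric_primitive k p q v w : (p + q)%N = k -> (k <= n)%N ->
  form Om k v -> primitive K p q w ->
  metric K v w = hodge_coef R n q p 0 *: vol (v * star w * kap ^+ (n - k)).
Proof.
move=> pq kn fv hw.
have fw : form Om k w by rewrite -pq; apply: bform_form (primitive_bform hw).
have hk : (k < (2 * n).+1)%N by lia.
rewrite /metric (bigD1 (Ordinal hk)) //= big1 ?addr0 => [|[i hi]]; last first.
  rewrite -val_eqE /= => ik; rewrite (component_other fsub fdir fv) // mul0r.
  exact: vol0.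
rewrite !(component_id fsub fdir) //.
have hs := primitive_star hw.
have e := hodge_primitive (j := 0%N) hs; rewrite mul1r subn0 in e.
have top : form Om (2 * n) (v * star w * kap ^+ (n - k)).
  have := formM (formM fv (star_form fw)) (bform_form (kappaX_bform K (n - k))).
  by congr (form _ _ _); lia.
rewrite e; last by lia.
rewrite addnC pq kappaX_comm -scalerAr mulrA.
exact: volZ.
Qed.

End Hodge.

(** * Tensors and extended connections *)

Section Tensor.
Variables (B A : nzRingType) (iota : {rmorphism B -> A}) (F : lmodType B).
Local Notation T := (tensor iota F).
Local Notation tens := (tens iota).
Implicit Types (a : A) (b : B) (x y : F) (s t : T) (S : set A).

Lemma scale_tens a a' x : a *: tens a' x = tens (a * a') x.
Proof. exact: tens_scaleE. Qed.

Lemma tensDl a a' x : tens (a + a') x = tens a x + tens a' x.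
Proof. by rewrite [RHS]tens_addE; apply/tens_classP; apply: tens_addl. Qed.

Lemma tensDr a x x' : tens a (x + x') = tens a x + tens a x'.
Proof. by rewrite [RHS]tens_addE; apply/tens_classP; apply: tens_addr. Qed.

Lemma tens_balanced a b x : tens (a * iota b) x = tens a (b *: x).
Proof. by apply/tens_classP; apply: tens_bal. Qed.

Lemma tens0l x : tens 0 x = 0.
Proof. by apply/tens_classP; apply: tens_0l. Qed.

Lemma tensNl a x : tens (- a) x = - tens a x.
Proof. by rewrite -scaleN1r scale_tens mulN1r. Qed.

Lemma tens_sub0 S : tens_sub S (0 : T).
Proof. by exists [::]; rewrite big_nil. Qed.

Lemma tens_subD S s t : tens_sub S s -> tens_sub S t -> tens_sub S (s + t).
Proof.
move=> [r [hr ->]] [r' [hr' ->]]; exists (r ++ r'); rewrite big_cat; split=> // p.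
by rewrite mem_cat => /orP[/hr|/hr'].
Qed.

Lemma tens_sub_tens S a x : S a -> tens_sub S (tens a x).
Proof.
by move=> Sa; exists [:: (a, x)]; rewrite big_seq1; split=> // p; rewrite inE => /eqP->.
Qed.

Lemma tens_sub_ind S (P : T -> Prop) : P 0 -> (forall s t, P s -> P t -> P (s + t)) ->
  (forall a x, S a -> P (tens a x)) -> forall t, tens_sub S t -> P t.
Proof.
move=> P0 PD PS t [r [hr ->]]; rewrite big_seq.
by elim/big_ind: _ => // -[a x] /hr; apply: PS.
Qed.

Lemma tensor_ind (P : T -> Prop) : P 0 -> (forall s t, P s -> P t -> P (s + t)) ->
  (forall a x, P (tens a x)) -> forall t, P t.
Proof.
move=> P0 PD PS; elim/tens_ind; elim=> [|[a x] r IH]; first exact: P0.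
by rewrite -cat1s -tens_addE; apply: (PD (tens a x) (tens_class iota r)).
Qed.

(** Reduces the change of bidegree of a tensor to that of its form coefficients. *)
Lemma tens_sub_scale S S' a t : (forall w, S w -> S' (a * w)) ->
  tens_sub S t -> tens_sub S' (a *: t).
Proof.
move=> h; move: t; apply: tens_sub_ind => [|s t hs ht|w x Sw].
- by rewrite scaler0; apply: tens_sub0.
- by rewrite scalerDr; apply: tens_subD.
by rewrite scale_tens; apply: tens_sub_tens; apply: h.
Qed.

Lemma tens_subS S S' t : (forall w, S w -> S' w) -> tens_sub S t -> tens_sub S' t.
Proof.
by move=> h; rewrite -{2}[t]scale1r; apply: tens_sub_scale => w; rewrite mul1r; apply: h.
Qed.

End Tensor.

Section Extension.
Variables (R : realType) (B : starAlgebra R) (Om : starCalculus B) (n : nat).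
Hypothesis Omdeg : total_degree Om (2 * n).
Variable F : lmodType B.
Local Notation T := (tensor (incl Om) F).
Local Notation tens := (tens (incl Om)).
Local Notation inc := (incl Om).
Implicit Types (v w : Om) (b : B) (x y : F) (s t : T).

Let fsub := form_subspace Om.
Let fdir := form_direct Om.

Lemma grade_sign_form k w : form Om k w -> grade_sign n w = (-1) ^+ k *: w.
Proof.
move=> fw; rewrite /grade_sign; case: (leqP k (2 * n)) => kn; last first.
  rewrite (Omdeg.2 _ _ kn fw) scaler0 big1 // => i _.
  by rewrite (component0 fsub fdir) scaler0.
have hk : (k < (2 * n).+1)%N by [].
rewrite (bigD1 (Ordinal hk)) //= (component_id fsub fdir fw) big1 ?addr0 // => -[i hi].
by rewrite -val_eqE /= => ik; rewrite (component_other fsub fdir fw) // scaler0.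
Qed.

Lemma grade_signD v w : grade_sign n (v + w) = grade_sign n v + grade_sign n w.
Proof.
rewrite /grade_sign -big_split; apply: eq_bigr => k _ /=.
by rewrite (componentD fsub fdir) scalerDr.
Qed.

Variables (delta : {linear Om -> Om}) (S : set Om) (D : F -> T).
Hypothesis delta_form : forall k w, form Om k w -> form Om k.+1 (delta w).
Hypothesis deltaM : forall k v w, form Om k v ->
  delta (v * w) = delta v * w + (-1) ^+ k *: (v * delta w).
Hypothesis delta_delta : forall w, delta (delta w) = 0.
Hypothesis Dconn : connection delta S D.

Local Notation ext := (extend n delta D).

Lemma connectionD x y : D (x + y) = D x + D y.
Proof. by have [_ h _] := Dconn; have := h 1 x y; rewrite !scale1r. Qed.

(** The map lifted by [extend]; the three facts below are the hypotheses of
   [tens_liftD] and [tens_lift_tens]. *)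
Let phi w x := tens (delta w) x + grade_sign n w *: D x.

Let phiDl v w x : phi (v + w) x = phi v x + phi w x.
Proof. by rewrite /phi linearD tensDl grade_signD scalerDl addrACA. Qed.

Let phiDr w x y : phi w (x + y) = phi w x + phi w y.
Proof. by rewrite /phi tensDr connectionD scalerDr addrACA. Qed.

Let phi_bal w b x : phi (w * inc b) x = phi w (b *: x).
Proof.
elim/form_ind: w => [|v w hv hw|k w fw].
- have h x' : phi 0 x' = 0 by apply: (@addrI _ (phi 0 x')); rewrite -phiDl !addr0.
  by rewrite mul0r !h.
- by rewrite mulrDl !phiDl hv hw.
have [_ _ Db] := Dconn.
have fwb : form Om k (w * inc b) by have := formM fw (form_incl Om b); rewrite addn0.
rewrite /phi (grade_sign_form fw) (grade_sign_form fwb) (deltaM _ fw) tensDl.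
rewrite tens_balanced Db scalerDr scale_tens scalerA -!scalerAl.
by rewrite -addrA.
Qed.

Lemma extendD s t : ext (s + t) = ext s + ext t.
Proof. exact: (tens_liftD phiDl phiDr phi_bal). Qed.

Lemma extend_tens w x : ext (tens w x) = tens (delta w) x + grade_sign n w *: D x.
Proof. exact: (tens_lift_tens phiDl phiDr phi_bal). Qed.

Lemma extend0 : ext 0 = 0.
Proof. by apply: (@addrI _ (ext 0)); rewrite -extendD !addr0. Qed.

Lemma extend_tens_form k w x : form Om k w ->
  ext (tens w x) = tens (delta w) x + ((-1) ^+ k *: w) *: D x.
Proof. by move=> fw; rewrite extend_tens (grade_sign_form fw). Qed.

Lemma extend_scale k w t : form Om k w ->
  ext (w *: t) = delta w *: t + ((-1) ^+ k *: w) *: ext t.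
Proof.
move=> fw; elim/tensor_ind: t => [|s t hs ht|v x].
- by rewrite !scaler0 !extend0 scaler0 addr0.
- by rewrite !scalerDr !extendD hs ht scalerDr addrACA.
elim/form_ind: v => [|v v' hv hv'|l v fv].
- by rewrite !tens0l !scaler0 !extend0 scaler0 addr0.
- by rewrite !tensDl !scalerDr !extendD hv hv' scalerDr addrACA.
rewrite !scale_tens (extend_tens_form _ (formM fw fv)) (extend_tens_form _ fv).
rewrite (deltaM _ fw) tensDl scalerDr scale_tens -!scalerAl addrA; congr (_ + _).
by rewrite scalerA -scalerAl -scalerAr scalerA exprD.
Qed.

(** The square of an extended connection is linear over forms: the two mixed terms
    of the Leibniz rule cancel. *)
Lemma extend_extend w x : ext (ext (tens w x)) = w *: ext (D x).
Proof.
elim/form_ind: w => [|v w hv hw|k w fw].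
- by rewrite tens0l !extend0 scale0r.
- by rewrite tensDl !extendD hv hw scalerDl.
rewrite (extend_tens_form _ fw) extendD (extend_tens_form _ (delta_form fw)).
rewrite (@extend_scale k) ?delta_delta ?tens0l ?add0r; last exact: subspaceZ.
rewrite linearZ /= addrA -scalerDl -scalerDl exprS mulN1r addNr.
rewrite !scale0r add0r.
by rewrite scalerA -expr2 sqrr_sign scale1r.
Qed.

Lemma extend_complex_scale (c : R[i]) t : ext ((c%:A : Om) *: t) = (c%:A : Om) *: ext t.
Proof.
have e : (c%:A : Om) = inc (c%:A) by rewrite linearZ /= rmorph1.
rewrite e (extend_scale _ (form_incl Om _)) expr0 scale1r -e linearZ /=.
by rewrite (graded_derivation1 deltaM) scaler0 scale0r add0r.
Qed.

End Extension.

(** * The form-valued hermitian pairing *)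

Section Pairing.
Variables (R : realType) (B : starAlgebra R) (Om : starCalculus B) (n : nat).
Variable K : kahlerStructure Om n.
Variables (F : lmodType B) (h : F -> F -> B).
Hypothesis hherm : hermitian_pairing h.
Local Notation T := (tensor (incl Om) F).
Local Notation tens := (tens (incl Om)).
Local Notation inc := (incl Om).
Local Notation kap := (kappa K).
Local Notation star := (star Om).
Local Notation pairing := (form_pairing h : T -> T -> Om).
Implicit Types (v w : Om) (b : B) (x y : F) (s t : T) (c : R[i]).

Let fsub := form_subspace Om.
Let bsub := bform_subspace K.

Lemma hermDl x x' y : h (x + x') y = h x y + h x' y.
Proof. by rewrite -[x in LHS]scale1r (herm_linear hherm) mul1r. Qed.

Lemma hermZl b x y : h (b *: x) y = b * h x y.
Proof.
have h0 : h 0 y = 0.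
  have := herm_linear hherm (-1) 0 0 y; rewrite scaler0 addr0 mulN1r addNr //.
by rewrite -[b *: x]addr0 (herm_linear hherm) h0 addr0.
Qed.

Lemma hermZr b x y : h x (b *: y) = h x y * astar b.
Proof. by rewrite -(herm_right hherm) astarK. Qed.

Let phi v x w y := v * inc (h x y) * star w.

Let phiDl v x w w' y : phi v x (w + w') y = phi v x w y + phi v x w' y.
Proof. by rewrite /phi starD mulrDr. Qed.

Let phiDr v x w y y' : phi v x w (y + y') = phi v x w y + phi v x w y'.
Proof. by rewrite /phi (herm_add hherm) rmorphD mulrDr mulrDl. Qed.

Let phi_bal v x w b y : phi v x (w * inc b) y = phi v x w (b *: y).
Proof. by rewrite /phi star_inclMr hermZr rmorphM !mulrA. Qed.

(** Linearity in the outer arguments holds summand by summand, whatever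
   representative of [t] the inner lift has chosen. *)
Let psi t v x := tens_lift (phi v x) t.

Let psiDl t v v' x : psi t (v + v') x = psi t v x + psi t v' x.
Proof.
rewrite /psi /tens_lift -big_split; apply: eq_bigr => p _.
by rewrite /phi /= !mulrDl.
Qed.

Let psiDr t v x x' : psi t v (x + x') = psi t v x + psi t v x'.
Proof.
rewrite /psi /tens_lift -big_split; apply: eq_bigr => p _.
by rewrite /phi /= hermDl rmorphD mulrDr mulrDl.
Qed.

Let psi_bal t v b x : psi t (v * inc b) x = psi t v (b *: x).
Proof.
rewrite /psi /tens_lift; apply: eq_bigr => p _.
by rewrite /phi /= hermZl rmorphM !mulrA.
Qed.

Lemma form_pairingDl s s' t : pairing (s + s') t = pairing s t + pairing s' t.
Proof. exact: (tens_liftD (psiDl t) (psiDr t) (psi_bal t)). Qed.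

Lemma form_pairing_tensl v x t : pairing (tens v x) t = tens_lift (phi v x) t.
Proof. exact: (tens_lift_tens (psiDl t) (psiDr t) (psi_bal t)). Qed.

Lemma form_pairing_tens v x w y : pairing (tens v x) (tens w y) = v * inc (h x y) * star w.
Proof.
by rewrite form_pairing_tensl (tens_lift_tens (phiDl v x) (phiDr v x) (phi_bal v x)).
Qed.

Lemma form_pairing0l t : pairing 0 t = 0.
Proof. by apply: (@addrI _ (pairing 0 t)); rewrite -form_pairingDl !addr0. Qed.

Lemma form_pairingDr s t t' : pairing s (t + t') = pairing s t + pairing s t'.
Proof.
elim/tensor_ind: s => [|s s' hs hs'|v x]; first by rewrite !form_pairing0l addr0.
  by rewrite !form_pairingDl hs hs' addrACA.
rewrite !form_pairing_tensl.
exact: (tens_liftD (phiDl v x) (phiDr v x) (phi_bal v x)).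
Qed.

Lemma form_pairing0r s : pairing s 0 = 0.
Proof. by apply: (@addrI _ (pairing s 0)); rewrite -form_pairingDr !addr0. Qed.

Lemma form_pairingZl v s t : pairing (v *: s) t = v * pairing s t.
Proof.
elim/tensor_ind: s => [|s s' hs hs'|w x].
- by rewrite scaler0 form_pairing0l mulr0.
- by rewrite scalerDr !form_pairingDl hs hs' mulrDr.
elim/tensor_ind: t => [|t t' ht ht'|u y].
- by rewrite !form_pairing0r mulr0.
- by rewrite !form_pairingDr ht ht' mulrDr.
by rewrite scale_tens !form_pairing_tens !mulrA.
Qed.

Lemma form_pairingZr k l w s t : form Om k w -> tens_sub (form Om l) t ->
  pairing s (w *: t) = (-1) ^+ (k * l) *: (pairing s t * star w).
Proof.
move=> fw; move: t; apply: tens_sub_ind => [|t t' ht ht'|u y fu].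
- by rewrite scaler0 form_pairing0r mul0r scaler0.
- by rewrite scalerDr !form_pairingDr ht ht' mulrDl scalerDr.
elim/tensor_ind: s => [|s s' hs hs'|v x].
- by rewrite !form_pairing0l mul0r scaler0.
- by rewrite !form_pairingDl hs hs' mulrDl scalerDr.
by rewrite scale_tens !form_pairing_tens (starM fw fu) -scalerAr !mulrA.
Qed.

Lemma form_pairing_kappar m s t : pairing s (kap ^+ m *: t) = pairing s t * kap ^+ m.
Proof.
elim/tensor_ind: t => [|t t' ht ht'|u y].
- by rewrite scaler0 form_pairing0r mul0r.
- by rewrite scalerDr !form_pairingDr ht ht' mulrDl.
elim/tensor_ind: s => [|s s' hs hs'|v x].
- by rewrite !form_pairing0l mul0r.
- by rewrite !form_pairingDl hs hs' mulrDl.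
by rewrite scale_tens !form_pairing_tens star_kappaM kappaX_comm mulrA.
Qed.

Lemma form_pairing_kappal m s t : pairing (kap ^+ m *: s) t = pairing s t * kap ^+ m.
Proof. by rewrite form_pairingZl kappaX_comm. Qed.

Lemma form_pairingBl s s' t : pairing (s - s') t = pairing s t - pairing s' t.
Proof. by rewrite form_pairingDl -scaleN1r form_pairingZl mulN1r. Qed.

Lemma form_pairingBr s t t' : pairing s (t - t') = pairing s t - pairing s t'.
Proof. by apply: (@addIr _ (pairing s t')); rewrite -form_pairingDr !subrK. Qed.

Lemma form_pairing_bform p q p' q' s t :
  tens_sub (bform K (p, q)) s -> tens_sub (bform K (p', q')) t ->
  bform K (p + q', q + p')%N (pairing s t).
Proof.
move=> hs ht; move: s hs; apply: tens_sub_ind => [|s s' hs hs'|v x hv].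
- by rewrite form_pairing0l; apply: (subspace0 (bsub _)).
- by rewrite form_pairingDl; apply: subspaceD.
move: t ht; apply: tens_sub_ind => [|t t' ht ht'|w y hw].
- by rewrite form_pairing0r; apply: (subspace0 (bsub _)).
- by rewrite form_pairingDr; apply: subspaceD.
rewrite form_pairing_tens; apply: bformM; first exact: bform_inclMr.
exact: bform_star.
Qed.

Lemma form_pairing_form k l s t :
  tens_sub (form Om k) s -> tens_sub (form Om l) t -> form Om (k + l) (pairing s t).
Proof.
move=> hs ht; move: s hs; apply: tens_sub_ind => [|s s' hs hs'|v x].
- by rewrite form_pairing0l; apply: (subspace0 (fsub _)).
- by rewrite form_pairingDl; apply: subspaceD.
move: v; apply: (form_bform_ind (K := K)) => [|v v' hv hv'|p q v <- hv].
- by rewrite tens0l form_pairing0l; apply: (subspace0 (fsub _)).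
- by rewrite tensDl form_pairingDl; apply: subspaceD.
move: t ht; apply: tens_sub_ind => [|t t' ht ht'|w y].
- by rewrite form_pairing0r; apply: (subspace0 (fsub _)).
- by rewrite form_pairingDr; apply: subspaceD.
move: w; apply: (form_bform_ind (K := K)) => [|w w' hw hw'|p' q' w <- hw].
- by rewrite tens0l form_pairing0r; apply: (subspace0 (fsub _)).
- by rewrite tensDl form_pairingDr; apply: subspaceD.
have hv' : tens_sub (bform K (p, q)) (tens v x) by apply: tens_sub_tens.
have hw' : tens_sub (bform K (p', q')) (tens w y) by apply: tens_sub_tens.
by have := bform_form (form_pairing_bform hv' hw'); congr (form _ _ _); lia.
Qed.

Variable nabla : F -> T.
Hypothesis nabla_conn : connection (dif Om) (form Om 1) nabla.
Hypothesis nabla_herm : forall x y, dif Om (inc (h x y)) =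
  pairing (nabla x) (tens 1 y) + pairing (tens 1 x) (nabla y).
Local Notation ext := (extend n (dif Om) nabla).

(** The compatibility of the Chern connection with the hermitian structure extends
    from the module to forms with values in it. *)
Lemma dif_form_pairing k s t : tens_sub (form Om k) s ->
  dif Om (pairing s t) = pairing (ext s) t + (-1) ^+ k *: pairing s (ext t).
Proof.
have extD := extendD (kappa_total K) (difM (c := Om)) nabla_conn.
have ext0 := extend0 (kappa_total K) (difM (c := Om)) nabla_conn.
have extE := extend_tens_form (kappa_total K) (difM (c := Om)) nabla_conn.
move=> hs; move: s hs; apply: tens_sub_ind => [|s s' hs hs'|v x fv].
- by rewrite ext0 !form_pairing0l linear0 scaler0 addr0.
- by rewrite extD !form_pairingDl linearD /= hs hs' scalerDr addrACA.
elim/tensor_ind: t => [|t t' ht ht'|w y].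
- by rewrite ext0 !form_pairing0r linear0 scaler0 addr0.
- by rewrite extD !form_pairingDr linearD /= ht ht' scalerDr addrACA.
elim/form_ind: w => [|w w' hw hw'|l w fw].
- by rewrite tens0l ext0 !form_pairing0r linear0 scaler0 addr0.
- by rewrite tensDl extD !form_pairingDr linearD /= hw hw' scalerDr addrACA.
have fvb : form Om k (v * inc (h x y)).
  by have := formM fv (form_incl Om (h x y)); rewrite addn0.
have [n1 _ _] := nabla_conn.
have fw' : form Om l ((-1) ^+ l *: w) by apply: subspaceZ.
have f1 : form Om 0 1 by rewrite -(rmorph1 inc); apply: form_incl.
rewrite (extE _ _ _ fv) (extE _ _ _ fw) form_pairingDl form_pairingDr !form_pairing_tens.
rewrite (form_pairingZr _ fw' (n1 y)) muln1 form_pairingZl.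
have -> : tens w y = w *: tens 1 y by rewrite scale_tens mulr1.
have hy : tens_sub (form Om 0) (tens 1 y) by apply: tens_sub_tens.
rewrite (form_pairingZr _ fw hy) muln0 scale1r.
have -> : tens v x = v *: tens 1 x by rewrite scale_tens mulr1.
rewrite form_pairingZl starZ rmorph_sign -!scalerAr scalerA -expr2 sqrr_sign scale1r.
rewrite (difM _ fvb) (difM _ fv) nabla_herm star_dif.
rewrite mulrDl -scalerAl mulrDr mulrDl !scalerDr -!scalerAl !mulrA !addrA.
by rewrite [RHS]addrAC.
Qed.

End Pairing.

(** * The inner product and the integral *)

Section Inner.
Variables (R : realType) (B : starAlgebra R) (Om : starCalculus B) (n : nat).
Variable K : kahlerStructure Om n.
Hypothesis Kpos : positive_definite K.
Variables (F : lmodType B) (h : F -> F -> B).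
Hypothesis hherm : hermitian_pairing h.
Variable f : {scalar B}.

Local Notation T := (tensor (incl Om) F).
Local Notation tens := (tens (incl Om)).
Local Notation inc := (incl Om).
Local Notation kap := (kappa K).
Local Notation pairing := (form_pairing h : T -> T -> Om).
Local Notation inner := (inner K h f : T -> T -> R[i]).
Local Notation integral := (integral K f).
Implicit Types (v w : Om) (b : B) (x y : F) (s t : T) (c : R[i]).

Let fsub := form_subspace Om.
Let bsub := bform_subspace K.

Lemma integral_form0 : integral 0 = 0.
Proof. by rewrite /integral -[degree0 _]/(vol K 0) vol0 // linear0. Qed.

Lemma integral_formD v w : form Om (2 * n) v -> form Om (2 * n) w ->
  integral (v + w) = integral v + integral w.
Proof.
move=> fv fw; rewrite /integral -![degree0 _]/(vol K _) volD //.
by rewrite linearD.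
Qed.

Lemma integral_formZ c v : form Om (2 * n) v -> integral (c *: v) = c * integral v.
Proof.
move=> fv; rewrite /integral -![degree0 _]/(vol K _) volZ //.
by rewrite linearZ.
Qed.

Lemma integral_formB v w : form Om (2 * n) v -> form Om (2 * n) w ->
  integral (v - w) = integral v - integral w.
Proof.
move=> fv fw; rewrite -(scaleN1r w) integral_formD ?integral_formZ ?mulN1r //.
exact: subspaceZ.
Qed.

Let phi v x w y := metric K (v * inc (h x y)) w.

Let metricDr v w w' : metric K v (w + w') = metric K v w + metric K v w'.
Proof. by rewrite -[w in LHS]scale1r metric_linearr // rmorph1 !scale1r. Qed.

Let metricDl v v' w : metric K (v + v') w = metric K v w + metric K v' w.
Proof. by rewrite -[v in LHS]scale1r metric_linearl // !scale1r. Qed.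

Let phiDl v x w w' y : phi v x (w + w') y = phi v x w y + phi v x w' y.
Proof. exact: metricDr. Qed.

Let phiDr v x w y y' : phi v x w (y + y') = phi v x w y + phi v x w y'.
Proof. by rewrite /phi (herm_add hherm) rmorphD mulrDr metricDl. Qed.

Let phi_bal v x w b y : phi v x (w * inc b) y = phi v x w (b *: y).
Proof. by rewrite /phi (hermZr hherm) rmorphM mulrA (metric_incl Kpos (astar b)) astarK. Qed.

Let psi t v x := tens_lift (phi v x) t.

Let psiDl t v v' x : psi t (v + v') x = psi t v x + psi t v' x.
Proof.
rewrite /psi /tens_lift -big_split; apply: eq_bigr => p _.
by rewrite /phi /= mulrDl metricDl.
Qed.

Let psiDr t v x x' : psi t v (x + x') = psi t v x + psi t v x'.
Proof.
rewrite /psi /tens_lift -big_split; apply: eq_bigr => p _.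
by rewrite /phi /= (hermDl hherm) rmorphD mulrDr metricDl.
Qed.

Let psi_bal t v b x : psi t (v * inc b) x = psi t v (b *: x).
Proof.
rewrite /psi /tens_lift; apply: eq_bigr => p _.
by rewrite /phi /= (hermZl hherm) rmorphM mulrA.
Qed.

Lemma innerDl s s' t : inner (s + s') t = inner s t + inner s' t.
Proof.
rewrite /inner /metricF -linearD; congr (f _).
exact: (tens_liftD (psiDl t) (psiDr t) (psi_bal t)).
Qed.

Let inner_tensl v x t : inner (tens v x) t = f (tens_lift (phi v x) t).
Proof. by congr (f _); apply: (tens_lift_tens (psiDl t) (psiDr t) (psi_bal t)). Qed.

Lemma inner_tens v x w y : inner (tens v x) (tens w y) = f (metric K (v * inc (h x y)) w).
Proof.
by rewrite inner_tensl (tens_lift_tens (phiDl v x) (phiDr v x) (phi_bal v x)).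
Qed.

Lemma inner0l t : inner 0 t = 0.
Proof. by apply: (@addrI _ (inner 0 t)); rewrite -innerDl !addr0. Qed.

Lemma innerDr s t t' : inner s (t + t') = inner s t + inner s t'.
Proof.
elim/tensor_ind: s => [|s s' hs hs'|v x]; first by rewrite !inner0l addr0.
  by rewrite !innerDl hs hs' addrACA.
rewrite !inner_tensl -linearD; congr (f _).
exact: (tens_liftD (phiDl v x) (phiDr v x) (phi_bal v x)).
Qed.

Lemma inner0r s : inner s 0 = 0.
Proof. by apply: (@addrI _ (inner s 0)); rewrite -innerDr !addr0. Qed.

Lemma innerZl c s t : inner ((c%:A : Om) *: s) t = c * inner s t.
Proof.
elim/tensor_ind: s => [|s s' hs hs'|v x]; first by rewrite scaler0 !inner0l mulr0.
  by rewrite scalerDr !innerDl hs hs' mulrDr.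
elim/tensor_ind: t => [|t t' ht ht'|w y]; first by rewrite !inner0r mulr0.
  by rewrite !innerDr ht ht' mulrDr.
rewrite scale_tens !inner_tens mulr_algl -scalerAl.
have e u : metric K (c *: u) w = c *: metric K u w.
  have m0 : metric K 0 w = 0 by apply: (@addrI _ (metric K 0 w)); rewrite -metricDl !addr0.
  by rewrite -[c *: u]addr0 metric_linearl // m0 addr0.
by rewrite e linearZ.
Qed.

Lemma innerZr c s t : inner s ((c%:A : Om) *: t) = c^* * inner s t.
Proof.
elim/tensor_ind: s => [|s s' hs hs'|v x]; first by rewrite !inner0l mulr0.
  by rewrite !innerDl hs hs' mulrDr.
elim/tensor_ind: t => [|t t' ht ht'|w y]; first by rewrite scaler0 !inner0r mulr0.
  by rewrite scalerDr !innerDr ht ht' mulrDr.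
rewrite scale_tens !inner_tens mulr_algl.
have e u : metric K u (c *: w) = c^* *: metric K u w.
  have m0 : metric K u 0 = 0 by apply: (@addrI _ (metric K u 0)); rewrite -metricDr !addr0.
  by rewrite -[c *: w]addr0 metric_linearr // m0 addr0.
by rewrite e linearZ.
Qed.

Lemma innerNr s t : inner s (- t) = - inner s t.
Proof. by apply: (@addrI _ (inner s t)); rewrite -innerDr !subrr inner0r. Qed.

Lemma inner_neq_degree k l s t : k != l ->
  tens_sub (form Om k) s -> tens_sub (form Om l) t -> inner s t = 0.
Proof.
move=> kl hs ht; move: s hs; apply: tens_sub_ind => [|s s' hs hs'|v x fv].
- exact: inner0l.
- by rewrite innerDl hs hs' addr0.
move: t ht; apply: tens_sub_ind => [|t t' ht ht'|w y fw].
- exact: inner0r.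
- by rewrite innerDr ht ht' addr0.
have fvb : form Om k (v * inc (h x y)).
  by have := formM fv (form_incl Om (h x y)); rewrite addn0.
by rewrite inner_tens (metric_neq_degree Kpos fvb fw kl) linear0.
Qed.

Lemma form_pairing_top k m s t : (k + m)%N = n ->
  tens_sub (form Om k) s -> tens_sub (form Om k) t ->
  form Om (2 * n) (pairing s t * kap ^+ m).
Proof.
move=> kmn hs ht.
have := formM (form_pairing_form K hherm hs ht) (bform_form (kappaX_bform K m)).
by congr (form _ _ _); lia.
Qed.

(** The basic formula: up to a constant, the inner product against a primitive
    tensor is the integral of the pairing against a power of [kappa]. *)
Lemma inner_primitive p q m s t : (p + q + m)%N = n ->
  tens_sub (form Om (p + q)) s -> tens_sub (primitive K p q) t ->
  inner s t = hodge_coef R n q p 0 * integral (pairing s t * kap ^+ m).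
Proof.
move=> pqm hs ht; have mE : m = (n - (p + q))%N by lia.
have pt : tens_sub (form Om (p + q)) t.
  by apply: tens_subS ht => w /primitive_bform/bform_form.
have {pt} top s' t' hs' ht' := @form_pairing_top (p + q) m s' t' pqm hs' ht'.
have Pf t' : tens_sub (primitive K p q) t' -> tens_sub (form Om (p + q)) t'.
  by apply: tens_subS => w /primitive_bform/bform_form.
(* The membership statements are carried through the two inductions because
   additivity of the integral is only available on top forms. *)
suff : tens_sub (form Om (p + q)) s /\ tens_sub (form Om (p + q)) t /\
    inner s t = hodge_coef R n q p 0 * integral (pairing s t * kap ^+ m) by case=> _ [].
move: s hs; apply: tens_sub_ind => [|s s' [hs [_ es]] [hs' [ht' es']]|v x fv].
- rewrite (form_pairing0l hherm) mul0r integral_form0 inner0l mulr0.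
  by split; [exact: tens_sub0|split=> //; apply: Pf].
- split; first exact: tens_subD; split=> //.
  rewrite innerDl es es' (form_pairingDl hherm) mulrDl integral_formD ?mulrDr //; exact: top.
have hvx : tens_sub (form Om (p + q)) (tens v x) by apply: tens_sub_tens.
split=> //; move: t ht.
apply: tens_sub_ind => [|t t' [ht et] [ht' et']|w y pw].
- rewrite (form_pairing0r hherm) mul0r integral_form0 inner0r mulr0.
  by split=> //; exact: tens_sub0.
- split; first exact: tens_subD.
  rewrite innerDr et et' (form_pairingDr hherm) mulrDl integral_formD ?mulrDr //; exact: top.
have hwy : tens_sub (form Om (p + q)) (tens w y).
  by apply: Pf; apply: tens_sub_tens.
split=> //; have fvb : form Om (p + q) (v * inc (h x y)).
  by have := formM fv (form_incl Om (h x y)); rewrite addn0.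
have pqn : (p + q <= n)%N by lia.
rewrite inner_tens (metric_primitive Kpos (erefl (p + q)%N) pqn fvb pw) linearZ /=.
by rewrite (form_pairing_tens hherm) -mE.
Qed.

Lemma antiholomorphic_tens_primitive k t : (k <= n)%N ->
  tens_sub (bform K (0, k)%N) t -> tens_sub (primitive K 0 k) t.
Proof. by move=> kn; apply: tens_subS => w; apply: antiholomorphic_primitive. Qed.

Lemma tens_bform_form p q t : tens_sub (bform K (p, q)) t -> tens_sub (form Om (p + q)) t.
Proof. by apply: tens_subS => w; apply: bform_form. Qed.

(** In equal total degree, the integrand has bidegree (n + p, n - p). *)
Lemma inner_neq_bidegree p q k s t : (p, q) != (0, k)%N -> (k <= n)%N ->
  tens_sub (bform K (p, q)) s -> tens_sub (bform K (0, k)%N) t -> inner s t = 0.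
Proof.
move=> ne kn hs ht; have [pqk|pqk] := eqVneq (p + q)%N k; last first.
  exact: inner_neq_degree pqk (tens_bform_form hs) (tens_bform_form ht).
have hs' := tens_bform_form hs; rewrite pqk in hs'.
rewrite (@inner_primitive 0 k (n - k)) ?subnKC //; last exact: antiholomorphic_tens_primitive.
have := bformM (form_pairing_bform hherm hs ht) (kappaX_bform K (n - k)).
move/bform_gt_eq0 => ->; rewrite ?integral_form0 ?mulr0 //.
have : p != 0%N by apply: contraNneq ne => p0; rewrite xpair_eqE -pqk p0 add0n !eqxx.
lia.
Qed.

Hypothesis fclosed : closed_integral K f.
Variable nabla : F -> T.
Hypothesis nabla_conn : connection (dif Om) (form Om 1) nabla.
Hypothesis nabla_herm : forall x y, dif Om (inc (h x y)) =
  pairing (nabla x) (tens 1 y) + pairing (tens 1 x) (nabla y).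
Local Notation ext := (extend n (dif Om) nabla).

Lemma extend_form k t : tens_sub (form Om k) t -> tens_sub (form Om k.+1) (ext t).
Proof.
move: t; apply: tens_sub_ind => [|s t hs ht|w x fw].
- by rewrite (extend0 (kappa_total K) (difM (c := Om)) nabla_conn); apply: tens_sub0.
- rewrite (extendD (kappa_total K) (difM (c := Om)) nabla_conn).
  exact: tens_subD.
rewrite (extend_tens_form (kappa_total K) (difM (c := Om)) nabla_conn _ fw).
apply: tens_subD; first by apply: tens_sub_tens; apply: form_dif.
have [n1 _ _] := nabla_conn; apply: tens_sub_scale (n1 x) => v fv.
by rewrite -addn1; apply: formM => //; apply: subspaceZ.
Qed.

(** Integration by parts: [kappa] is closed, so exactly the two covariant
    derivatives contribute to the integral of the exact form. *)
Lemma stokes_form_pairing k l m s t : (k + l + m.*2).+1 = (2 * n)%N ->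
  tens_sub (form Om k) s -> tens_sub (form Om l) t ->
  integral (pairing (ext s) t * kap ^+ m) = - (-1) ^+ k * integral (pairing s (ext t) * kap ^+ m).
Proof.
move=> klm hs ht.
have fkap : form Om (m.*2) (kap ^+ m) by rewrite -addnn; apply: bform_form (kappaX_bform K m).
have fst := formM (form_pairing_form K hherm hs ht) fkap.
have f1 : form Om (2 * n) (pairing (ext s) t * kap ^+ m).
  have := formM (form_pairing_form K hherm (extend_form hs) ht) fkap.
  by rewrite -klm !addSn.
have f2 : form Om (2 * n) (pairing s (ext t) * kap ^+ m).
  have := formM (form_pairing_form K hherm hs (extend_form ht)) fkap.
  by rewrite -klm addnS addSn.
have := fclosed klm fst.
rewrite dif_kappaM (dif_form_pairing K hherm nabla_conn nabla_herm t hs).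
rewrite mulrDl -scalerAl integral_formD //; last exact: subspaceZ.
by rewrite integral_formZ // => /eqP; rewrite addr_eq0 mulNr => /eqP.
Qed.

Hypothesis inner_pos : forall t, t != 0 -> 0 < inner t t.

Lemma inner_ge0 t : 0 <= inner t t.
Proof.
by have [->|/inner_pos/ltW//] := eqVneq t 0; rewrite inner0l.
Qed.

Lemma inner_eq0 t : inner t t = 0 -> t = 0.
Proof. by move=> e; apply: contraTeq isT => /inner_pos; rewrite e ltxx. Qed.

(** Polarisation: the values at [s + t] and [s + i t] are real. *)
Lemma inner_sym s t : inner s t = (inner t s)^*.
Proof.
have real u : complex.Im (inner u u) = 0.
  by have := inner_ge0 u; rewrite lecE => /andP[/eqP].
have := real (s + ('i%:A : Om) *: t); have := real (s + t).
rewrite !(innerDl, innerDr) !(innerZl, innerZr).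
have := real s; have := real t.
case: (inner s s) => a0 b0; case: (inner t t) => a1 b1.
case: (inner s t) => a b; case: (inner t s) => c d /=.
move=> -> -> e1 e2; congr (_ +i* _); lra.
Qed.

Lemma adjoint_unique (D : T -> T) t t' : (forall s, inner (D s) t = inner s t') ->
  adjoint K h f D t = t'.
Proof.
move=> e; apply: xget_unique => //= t'' e'.
apply/eqP; rewrite -subr_eq0; apply/eqP/inner_eq0.
by rewrite innerDr innerNr -e -e' subrr.
Qed.

End Inner.

(** * Signs and constants *)

Section HodgeSign.
Variable R : realType.

(** The constant by which the Hodge map acts on primitive (k,0)-forms, up to a
    factorial. *)
Definition hodge_sign (k : nat) : R[i] := (-1) ^+ (k * k.+1)./2 * 'i ^+ k.

Lemma mul_ii : 'i * 'i = -1 :> R[i].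
Proof. by rewrite -expr2 sqr_i. Qed.

Lemma i_neq0 : 'i != 0 :> R[i].
Proof. by apply/eqP => -[] /eqP; rewrite oner_eq0. Qed.

Lemma mulcJ_nat_i k : (- (k%:R * 'i)) * (- (k%:R * 'i))^* = k%:R ^+ 2 :> R[i].
Proof.
rewrite rmorphN rmorphM rmorph_nat mulrNN mulrACA -expr2.
have -> : 'i * 'i^* = 1 :> R[i].
  by apply/eqP; rewrite eq_complex /= !(mulr0, mul0r, mulr1, mul1r, sub0r, addr0, opprK) !eqxx.
by rewrite mulr1.
Qed.

Lemma hodge_signS k : hodge_sign k.+1 = hodge_sign k * ((-1) ^+ k.+1 * 'i).
Proof.
rewrite /hodge_sign.
have -> : ((k.+1 * k.+2)./2 = (k * k.+1)./2 + k.+1)%N.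
  have -> : (k.+1 * k.+2 = k * k.+1 + k.+1.*2)%N by lia.
  by rewrite halfD odd_double andbF doubleK.
by rewrite exprD ['i ^+ _]exprSr mulrACA.
Qed.

Lemma hodge_signSS k : hodge_sign k.+2 = hodge_sign k.
Proof.
rewrite !hodge_signS -mulrA [(-1) ^+ k.+2]exprS mulN1r mulNr mulrN.
by rewrite mulrACA mul_ii -expr2 sqrr_sign mul1r opprK mulr1.
Qed.

Lemma hodge_coef_antiholomorphic n k :
  hodge_coef R n k 0 0 = hodge_sign k / (n - k)`!%:R.
Proof. by rewrite /hodge_coef addn0 subr0 subn0 mul1r. Qed.

Lemma hodge_coef_k1 n k :
  hodge_coef R n k 1 0 = - hodge_sign k.+1 / (n - k.+1)`!%:R.
Proof.
rewrite /hodge_coef addn1 subn0 mul1r /hodge_sign; congr (_ / _).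
have -> : k%:Z - 1%:Z = k.+1%:Z - 2%:Z by lia.
rewrite expfzDr ?i_neq0 // -exprnN -exprnP.
have -> : ('i : R[i]) ^- 2 = -1 by rewrite expr2 mul_ii invrN1.
by rewrite mulrN1 mulrN.
Qed.

End HodgeSign.

(** The constants of [inner_delbar], over an abstract field: [S] is the Hodge sign of
    degree [k], [M] is [m!], [g] is [(-1)^k] and [j] is the imaginary unit. *)
Lemma adjoint_coef (C : fieldType) (S M m g j X Y : C) :
  S != 0 -> M != 0 -> j != 0 -> g ^+ 2 = 1 ->
  M / (S * (- g * j)) * X = - g * (m * M / S * Y) -> X = m * j * Y.
Proof.
move=> S0 M0 j0 gg e.
have g0 : g != 0 by apply/eqP => g0; move/eqP: gg; rewrite g0 expr0n /= eq_sym oner_eq0.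
have -> : X = (S * (- g * j) / M) * (M / (S * (- g * j)) * X).
  by field; rewrite ?oppr_eq0 M0 S0 j0 g0.
rewrite e; transitivity (g ^+ 2 * m * j * Y); last by rewrite gg mul1r.
by field; rewrite M0 S0.
Qed.

(** The constants of [akizuki_nakano], with the conventions of [adjoint_coef]; [X0],
    [X2], [X3] are the squared norms of [t], of its antiholomorphic derivative and of
    [beta].  The hypothesis is the curvature equation integrated by parts, and the
    left-hand side of the conclusion is the squared norm of [alpha]. *)
Lemma nakano_coef (C : fieldType) (S M m g j X0 X2 X3 I1 th : C) :
  S != 0 -> M != 0 -> m + 1 != 0 -> m + 2%:R != 0 -> j != 0 -> g != 0 ->
  g ^+ 2 = 1 -> j * j = -1 ->
  I1 + M / (S * (- g * j)) * X2 = g * (th * j) * ((m + 1) * M / S * X0) ->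
  - (S * (- g * j)) / M * (I1 - (m + 2%:R) * ((m + 1) * M) / (S * (- g * j)) * X3)
  = X2 + (m + 2%:R) * (m + 1) * X3 - th * (m + 1) * X0.
Proof.
move=> S0 M0 m0 m1 j0 g0 gg jj e.
have -> : I1 = g * (th * j) * ((m + 1) * M / S * X0) - M / (S * (- g * j)) * X2.
  by rewrite -e addrK.
have -> : X2 + (m + 2%:R) * (m + 1) * X3 - th * (m + 1) * X0 =
  X2 + (m + 2%:R) * (m + 1) * X3 + g ^+ 2 * (j * j) * th * (m + 1) * X0.
  by rewrite gg jj; ring.
by field; rewrite ?oppr_eq0 ?M0 ?S0 ?j0 ?g0.
Qed.

(** * The Akizuki-Nakano inequality *)

Section SpectralGap.
Variables (R : realType) (B : starAlgebra R) (Om : starCalculus B) (n : nat).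
Variable K : kahlerStructure Om n.
Variables (f : {scalar B}) (F : lmodType B) (h : F -> F -> B).
Local Notation T := (tensor (incl Om) F).
Variables (dbarF nabla : F -> T) (theta : R).
Hypothesis Kpos : positive_definite K.
Hypothesis fclosed : closed_integral K f.
Hypothesis hherm : hermitian_pairing h.
Hypothesis holo : holomorphic K dbarF.
Hypothesis hchern : chern K h dbarF nabla.
Hypothesis theta_gt0 : 0 < theta.
Hypothesis curvature : forall x : F, extend n (dif Om) nabla (nabla x)
     = tens (incl Om) ((theta%:C * 'i) *: kappa K) x.
Hypothesis inner_pos : forall t : T, t != 0 -> 0 < inner K h f t t.

Local Notation tens := (tens (incl Om)).
Local Notation inc := (incl Om).
Local Notation kap := (kappa K).
Local Notation pairing := (form_pairing h : T -> T -> Om).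
Local Notation inner := (inner K h f : T -> T -> R[i]).
Local Notation integral := (integral K f).
(* [nb] is the Chern connection and [db] its antiholomorphic part, both extended to
   twisted forms. *)
Local Notation db := (extend n (delbar K) dbarF).
Local Notation nb := (extend n (dif Om) nabla).
Local Notation adj := (adjoint K h f (extend n (delbar K) dbarF)).
Local Notation Tb p q := (tens_sub (bform K (p, q)) : set T).
Implicit Types (v w : Om) (x y : F) (s t beta : T) (c : R[i]).

Let fsub := form_subspace Om.
Let bsub := bform_subspace K.

Let dbarF_conn : connection (delbar K) (bform K (0, 1)%N) dbarF.
Proof. by case: holo. Qed.

Let nabla_conn : connection (dif Om) (form Om 1) nabla.
Proof. by case: hchern. Qed.

Let nabla_herm x y : dif Om (inc (h x y)) =
  pairing (nabla x) (tens 1 y) + pairing (tens 1 x) (nabla y).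
Proof. by case: hchern. Qed.

Let delbar_form k w : form Om k w -> form Om k.+1 (delbar K w).
Proof.
move: w; apply: (form_bform_ind (K := K)) => [|v w hv hw|p q w <- hw].
- by rewrite linear0; apply: (subspace0 (fsub _)).
- by rewrite linearD; apply: subspaceD.
by rewrite -addnS; apply: bform_form (bform_delbar hw).
Qed.

Let nbD s t : nb (s + t) = nb s + nb t.
Proof. exact: (extendD (kappa_total K) (difM (c := Om)) nabla_conn). Qed.
Let nb0 : nb 0 = 0.
Proof. exact: (extend0 (kappa_total K) (difM (c := Om)) nabla_conn). Qed.
Let nbE k w x : form Om k w -> nb (tens w x) = tens (dif Om w) x + ((-1) ^+ k *: w) *: nabla x.
Proof. by move=> fw; exact: (extend_tens_form (kappa_total K) (difM (c := Om)) nabla_conn). Qed.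
Let dbD s t : db (s + t) = db s + db t.
Proof. exact: (extendD (kappa_total K) (delbarM K) dbarF_conn). Qed.
Let db0 : db 0 = 0.
Proof. exact: (extend0 (kappa_total K) (delbarM K) dbarF_conn). Qed.
Let dbE k w x : form Om k w ->
  db (tens w x) = tens (delbar K w) x + ((-1) ^+ k *: w) *: dbarF x.
Proof. by move=> fw; exact: (extend_tens_form (kappa_total K) (delbarM K) dbarF_conn). Qed.

Let dbZ c t : db ((c%:A : Om) *: t) = (c%:A : Om) *: db t.
Proof. exact: (extend_complex_scale (kappa_total K) (delbarM K) dbarF_conn). Qed.

Let dbdb t : db (db t) = 0.
Proof.
elim/tensor_ind: t => [|s t hs ht|w x]; first by rewrite !db0.
  by rewrite !dbD hs ht addr0.
rewrite (extend_extend (kappa_total K) delbar_form (delbarM K) (delbar_delbar K) dbarF_conn).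
by have [_ _ ->] := holo; rewrite scaler0.
Qed.

Let nbnb t : nb (nb t) = ((theta%:C * 'i) *: kap) *: t.
Proof.
elim/tensor_ind: t => [|s t hs ht|w x]; first by rewrite !nb0 scaler0.
  by rewrite !nbD hs ht scalerDr.
rewrite (extend_extend (kappa_total K) (form_dif (c := Om)) (difM (c := Om))
  (dif_dif (c := Om)) nabla_conn).
by rewrite curvature !scale_tens -scalerAl -scalerAr kappa_central.
Qed.

Lemma db_bform p q t : Tb p q t -> Tb p q.+1 (db t).
Proof.
move: t; apply: tens_sub_ind => [|s t hs ht|w x hw].
- by rewrite db0; apply: tens_sub0.
- by rewrite dbD; apply: tens_subD.
rewrite (dbE _ (bform_form hw)); apply: tens_subD.
  by apply: tens_sub_tens; apply: bform_delbar.
have [d1 _ _] := dbarF_conn; apply: tens_sub_scale (d1 x) => v hv.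
by have := bformM (subspaceZ (bsub _) ((-1) ^+ (p + q)) hw) hv; rewrite addn0 addn1.
Qed.

Lemma nb_split p q t : Tb p q t -> Tb p.+1 q (nb t - db t).
Proof.
move: t; apply: tens_sub_ind => [|s t hs ht|w x hw].
- by rewrite db0 nb0 subrr; apply: tens_sub0.
- by rewrite nbD dbD opprD addrACA; apply: tens_subD.
rewrite (dbE _ (bform_form hw)) (nbE _ (bform_form hw)) (dif_split K) tensDl.
rewrite opprD addrACA addrK -scalerBr; apply: tens_subD.
  by apply: tens_sub_tens; apply: bform_del.
have [_ _ d1] := hchern; apply: tens_sub_scale (d1 x) => v hv.
by have := bformM (subspaceZ (bsub _) ((-1) ^+ (p + q)) hw) hv; rewrite addn0 addn1.
Qed.

Lemma tens_bform_gt_eq0 p q t : Tb p q t -> (n < p)%N || (n < q)%N -> t = 0.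
Proof.
move=> + pq; move: t; apply: tens_sub_ind => [//|s t -> ->|w x hw]; first by rewrite addr0.
by rewrite (bform_gt_eq0 hw pq) tens0l.
Qed.

(** Discards from an integrand the terms whose bidegree is not (n,n). *)
Lemma pairing_gt_eq0 p q p' q' m s t : Tb p q s -> Tb p' q' t ->
  (n < p + q' + m)%N || (n < q + p' + m)%N -> pairing s t * kap ^+ m = 0.
Proof.
move=> hs ht.
exact: bform_gt_eq0 (bformM (form_pairing_bform hherm hs ht) (kappaX_bform K m)).
Qed.

(** The Lefschetz decomposition [p = alpha + kappa beta] of a twisted (1,k)-form.  The
    form [beta] is found on generators, as [kappa^m w] always lies in the image of
    [kappa^(m + 1)]; for [k = 0] that image is zero in the relevant bidegree. *)
Lemma lefschetz_split k m p : (k + m)%N = n -> Tb 1 k p -> exists beta,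
  [/\ Tb 0 k.-1 beta, (k = 0%N -> beta = 0),
      kap ^+ m *: p = kap ^+ m.+1 *: beta
    & (0 < m)%N -> tens_sub (primitive K 1 k) (p - kap *: beta)].
Proof.
move=> kmn; move: p; apply: tens_sub_ind => [|s t [beta [b1 b2 b3 b4]] [c [c1 c2 c3 c4]]|w x hw].
- exists 0; split=> [|//||_]; [exact: tens_sub0|by rewrite !scaler0|].
  by rewrite scaler0 subr0; exact: tens_sub0.
- exists (beta + c); split; first exact: tens_subD.
  + by move=> k0; rewrite b2 // c2 // addr0.
  + by rewrite !scalerDr b3 c3.
  by move=> m0; rewrite scalerDr opprD addrACA; apply: tens_subD; [apply: b4|apply: c4].
have e : (1 + m + (k + m) = n + m.+1)%N by lia.
have kw0 u : kap ^+ m.+1 * u = kap ^+ m * w -> kap ^+ m * (w - kap * u) = 0.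
  by move=> uE; rewrite mulrBr mulrA -exprSr uE subrr.
have prim u : bform K (1, k)%N (kap * u) -> kap ^+ m.+1 * u = kap ^+ m * w ->
    (0 < m)%N -> primitive K 1 k (w - kap * u).
  move=> hu uE m0; apply/primitiveE; split; first exact: subspaceB.
  have -> : ((n - (1 + k)).+1 = m)%N by lia.
  exact: kw0.
case: (lefschetz_bform e (bform_kappaM m hw)) => [w0|[_ mk [u]]].
  exists 0; split=> [|//||m0]; [exact: tens_sub0|by rewrite scale_tens w0 tens0l scaler0|].
  rewrite scaler0 subr0; apply: tens_sub_tens; rewrite -[w]subr0 -(mulr0 kap).
  by apply: prim; rewrite ?mulr0 ?w0 //; apply: (subspace0 (bsub _)).
have -> : (1 + m - m.+1 = 0)%N by lia.
have -> : (k + m - m.+1 = k.-1)%N by lia.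
have k0 : (0 < k)%N by lia.
move=> hu uE; exists (tens u x); split.
- exact: tens_sub_tens.
- by move=> kE; rewrite kE in k0.
- by rewrite !scale_tens uE.
move=> m0; rewrite scale_tens -tensNl -tensDl; apply: tens_sub_tens.
apply: prim => //; rewrite -[kap]expr1.
have := bform_kappaM 1 hu; rewrite add0n.
by congr (bform _ (_, _) _); lia.
Qed.

Local Notation scal c := ((c%:A : Om)).

Lemma inner_antiholomorphic k m s t : (k + m)%N = n -> tens_sub (form Om k) s -> Tb 0 k t ->
  inner s t = hodge_sign R k / m`!%:R * integral (pairing s t * kap ^+ m).
Proof.
move=> kmn hs ht.
rewrite (@inner_primitive _ _ _ _ _ Kpos _ _ hherm f 0 k m s t) ?add0n //; last first.
  by apply: antiholomorphic_tens_primitive => //; lia.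
by rewrite hodge_coef_antiholomorphic; congr (_ / _`!%:R * _); lia.
Qed.

Let fact_neq0 m : m`!%:R != 0 :> R[i].
Proof. by rewrite pnatr_eq0 -lt0n fact_gt0. Qed.

Let hodge_sign_neq0 k : hodge_sign R k != 0.
Proof. by rewrite mulf_neq0 // ?signr_eq0 // expf_neq0 // i_neq0. Qed.

Lemma integral_antiholomorphic k m s t : (k + m)%N = n -> tens_sub (form Om k) s -> Tb 0 k t ->
  integral (pairing s t * kap ^+ m) = m`!%:R / hodge_sign R k * inner s t.
Proof.
move=> kmn hs ht; rewrite (inner_antiholomorphic kmn hs ht).
have := hodge_sign_neq0 k; have := fact_neq0 m.
move: (hodge_sign R k) (m`!%:R : R[i]) => S M M0 S0; field.
by rewrite M0 S0.
Qed.

(** Integration by parts moves the derivative from [s] to [t].  For reasons of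
    bidegree only the antiholomorphic part of [nabla s] and the (1,0)-part of [nabla t]
    contribute, and the latter may be replaced by its trace part [kappa beta]. *)
Lemma inner_delbar k m beta s t : (k.+1 + m)%N = n -> Tb 0 k s -> Tb 0 k.+1 t ->
  Tb 0 k beta -> kap ^+ m *: (nb t - db t) = kap ^+ m.+1 *: beta ->
  inner (db s) t = m.+1%:R * 'i * inner s beta.
Proof.
move=> kmn hs ht hbeta betaE.
have fs := tens_bform_form hs; have ft := tens_bform_form ht.
have fdbs := tens_bform_form (db_bform hs).
have e1 : pairing (nb s) t * kap ^+ m = pairing (db s) t * kap ^+ m.
  rewrite -[nb s](subrK (db s)) (form_pairingDl hherm) mulrDl.
  by rewrite (pairing_gt_eq0 (nb_split hs) ht) ?add0r //; lia.
have e2 : pairing s (nb t) * kap ^+ m = pairing s beta * kap ^+ m.+1.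
  rewrite -[nb t](subrK (db t)) (form_pairingDr hherm) mulrDl.
  rewrite (pairing_gt_eq0 hs (db_bform ht)) ?addr0; last by lia.
  by rewrite -!(form_pairing_kappar K hherm) betaE.
have deg : (k + k.+1 + m.*2).+1 = (2 * n)%N by lia.
have km' : (k + m.+1)%N = n by lia.
have := stokes_form_pairing Kpos hherm fclosed nabla_conn nabla_herm deg fs ft.
rewrite e1 e2 (integral_antiholomorphic kmn fdbs ht) (integral_antiholomorphic km' fs hbeta) => e.
move: e; rewrite hodge_signS factS natrM exprS mulN1r.
by apply: adjoint_coef; rewrite ?sqrr_sign ?i_neq0 ?fact_neq0 ?hodge_sign_neq0.
Qed.

(** The Kaehler identity for the adjoint of the antiholomorphic differential: a test
    tensor [s] in any bidegree other than (0,k-1) contributes zero to both sides. *)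
Lemma inner_delbar_contraction k m beta t : (k + m)%N = n -> Tb 0 k t ->
  Tb 0 k.-1 beta -> (k = 0%N -> beta = 0) ->
  kap ^+ m *: (nb t - db t) = kap ^+ m.+1 *: beta ->
  forall s, inner (db s) t = inner s (scal (- (m.+1%:R * 'i)) *: beta).
Proof.
move=> kmn ht hbeta beta0 betaE; have kn : (k <= n)%N by lia.
set c : R[i] := - _.
elim/tensor_ind => [|s s' es es'|w x].
- by rewrite db0 !inner0l.
- by rewrite dbD !innerDl // es es'.
elim/(bform_ind (K := K)): w => [|v w ev ew|p q w hw].
- by rewrite tens0l db0 !inner0l.
- by rewrite tensDl dbD !innerDl // ev ew.
have hs : Tb p q (tens w x) by apply: tens_sub_tens.
case: k kn kmn ht hbeta beta0 betaE @c => [|k] kn kmn ht hbeta beta0 betaE c.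
  rewrite beta0 // scaler0 inner0r //.
  apply: (inner_neq_bidegree Kpos hherm f _ kn (db_bform hs) ht).
  by rewrite xpair_eqE andbF.
have [e|ne] := eqVneq (p, q) (0, k)%N.
  case: e => p0 q0; rewrite p0 q0 in hs.
  rewrite (inner_delbar kmn hs ht hbeta betaE) innerZr //; congr (_ * _).
  rewrite /c rmorphN rmorphM rmorph_nat /= -mulrN; congr (_ * _).
  by congr (_ +i* _); rewrite ?oppr0 ?opprK.
rewrite innerZr // (inner_neq_bidegree Kpos hherm f ne _ hs hbeta) ?mulr0 //; last by lia.
apply: (inner_neq_bidegree Kpos hherm f _ _ (db_bform hs) ht) => //.
Qed.

Lemma adjoint_exists k t : Tb 0 k t -> exists beta, [/\ Tb 0 k.-1 beta, (k = 0%N -> beta = 0)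
  & forall s, inner (db s) t = inner s beta].
Proof.
move=> ht; case: (leqP k n) => kn; last first.
  exists 0; split=> [|//|s]; first exact: tens_sub0.
  by rewrite (tens_bform_gt_eq0 ht) ?inner0r // kn orbT.
have kmn : (k + (n - k))%N = n by rewrite subnKC.
have [beta [hbeta beta0 betaE _]] := lefschetz_split kmn (nb_split ht).
exists (scal (- ((n - k).+1%:R * 'i)) *: beta); split.
- rewrite -[_ *: beta]addr0; apply: tens_subD; last exact: tens_sub0.
  by apply: tens_sub_scale hbeta => w hw; rewrite mulr_algl; apply: subspaceZ.
- by move=> k0; rewrite beta0 // scaler0.
exact: inner_delbar_contraction kmn ht hbeta beta0 betaE.
Qed.

Lemma inner_adjoint k t s : Tb 0 k t -> inner (db s) t = inner s (adj t).
Proof.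
by move=> /adjoint_exists [beta [_ _ e]]; rewrite (adjoint_unique Kpos hherm inner_pos e).
Qed.

Let adj_bform k t : Tb 0 k t -> Tb 0 k.-1 (adj t) /\ (k = 0%N -> adj t = 0).
Proof.
by move=> /adjoint_exists [beta [hbeta beta0 e]]; rewrite (adjoint_unique Kpos hherm inner_pos e).
Qed.

(** The squared norm of the primitive part [alpha] of the (1,0)-derivative of [t] is
    non-negative; Stokes' theorem and the curvature equation turn this into the
    inequality. *)
Lemma akizuki_nakano k m t : (k + m.+1)%N = n -> Tb 0 k t ->
  theta%:C * m.+1%:R * inner t t <= inner (db t) (db t) + inner (adj t) (adj t).
Proof.
move=> kmn ht; have kmn' : (k.+1 + m)%N = n by rewrite -addSnnS in kmn.
have [p hp pE] : exists2 p, Tb 1 k p & nb t = p + db t.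
  by exists (nb t - db t); [apply: nb_split|rewrite subrK].
have [beta [hbeta beta0 betaE alphaP]] := lefschetz_split kmn hp.
have {}alphaP := alphaP isT; set alpha := p - kap *: beta in alphaP.
have adE : adj t = scal (- (m.+2%:R * 'i)) *: beta.
  apply: (adjoint_unique Kpos hherm inner_pos).
  by apply: (inner_delbar_contraction kmn ht hbeta beta0); rewrite pE addrK.
have alpha0 : kap ^+ m.+1 *: alpha = 0.
  by rewrite scalerBr scalerA -exprSr betaE subrr.
have ft := tens_bform_form ht; have fdt := tens_bform_form (db_bform ht).
have form_p := tens_bform_form hp.
have top_beta : form Om (2 * n) (pairing beta beta * kap ^+ m.+2).
  case: k kmn {kmn'} hbeta beta0 {ht adE ft fdt form_p hp alphaP} => [|k] kmn hbeta beta0.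
    by rewrite beta0 // (form_pairing0r hherm) mul0r; apply: (subspace0 (fsub _)).
  have form_beta := tens_bform_form hbeta.
  by apply: (form_pairing_top K hherm _ form_beta form_beta); lia.
(* [alpha] is killed by [kappa^(m + 1)], hence orthogonal to [kappa beta]. *)
have alphaE : pairing alpha alpha * kap ^+ m =
    pairing p p * kap ^+ m - pairing beta beta * kap ^+ m.+2.
  have kap1 u : kap *: u = kap ^+ 1 *: u :> T by [].
  rewrite {1}/alpha (form_pairingBl hherm) mulrBl kap1 (form_pairing_kappal K hherm).
  rewrite -mulrA -exprS -(form_pairing_kappar K hherm m.+1) alpha0 (form_pairing0r hherm) subr0.
  rewrite /alpha (form_pairingBr hherm) mulrBl kap1 (form_pairing_kappar K hherm).
  rewrite -mulrA -exprS -(form_pairing_kappal K hherm m.+1) betaE (form_pairing_kappal K hherm).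
  by [].
have top1 : form Om (2 * n) (pairing p p * kap ^+ m).
  by apply: (form_pairing_top K hherm _ form_p form_p); lia.
have fal : tens_sub (form Om (1 + k)) alpha.
  by apply: tens_subS alphaP => w /primitive_bform/bform_form.
have norm_alpha : inner alpha alpha = - hodge_sign R k.+1 / m`!%:R *
    (integral (pairing p p * kap ^+ m) - integral (pairing beta beta * kap ^+ m.+2)).
  have kmn1 : (1 + k + m)%N = n by lia.
  rewrite (inner_primitive Kpos hherm f kmn1 fal alphaP) alphaE hodge_coef_k1.
  rewrite integral_formB //.
  by congr (- _ / _`!%:R * _); lia.
have stokes : integral (pairing p p * kap ^+ m) + integral (pairing (db t) (db t) * kap ^+ m)
    = (-1) ^+ k * (theta%:C * 'i) * integral (pairing t t * kap ^+ m.+1).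
  have deg : (k + k.+1 + m.*2).+1 = (2 * n)%N by lia.
  have fnt : tens_sub (form Om k.+1) (nb t) by apply: extend_form.
  have := stokes_form_pairing Kpos hherm fclosed nabla_conn nabla_herm deg ft fnt.
  have -> : pairing (nb t) (nb t) * kap ^+ m =
      pairing p p * kap ^+ m + pairing (db t) (db t) * kap ^+ m.
    rewrite pE (form_pairingDl hherm) !(form_pairingDr hherm) !mulrDl.
    rewrite (pairing_gt_eq0 hp (db_bform ht)); last by lia.
    by rewrite (pairing_gt_eq0 (db_bform ht) hp) ?addr0 ?add0r //; lia.
  rewrite integral_formD //; last by apply: (form_pairing_top K hherm kmn' fdt fdt).
  move=> ->; rewrite nbnb.
  have fkap : form Om 2 ((theta%:C * 'i) *: kap).
    by apply: subspaceZ => //; apply: bform_form (kappa_bform K).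
  rewrite (form_pairingZr hherm _ fkap ft) exprM sqrrN !expr1n scale1r.
  rewrite starZ kappa_real -scalerAr -scalerAl -[_ * kap * _]mulrA -exprS.
  rewrite integral_formZ //; last first.
    exact: (form_pairing_top K hherm kmn ft ft).
  rewrite mulrA; congr (_ * _); rewrite mulNr -mulrN; congr (_ * _).
  by apply/eqP; rewrite eq_complex /= !(mulr0, mul0r, mulr1, subr0, addr0, oppr0, opprK) !eqxx.
have integral_beta : integral (pairing beta beta * kap ^+ m.+2) =
    m.+2`!%:R / hodge_sign R k.+1 * inner beta beta.
  case: k kmn kmn' hbeta beta0 {ht adE ft fdt form_p hp alphaP fal norm_alpha stokes}
    => [|k] kmn kmn' hbeta beta0.
    by rewrite beta0 // (form_pairing0r hherm) mul0r integral_form0 // inner0l // mulr0.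
  rewrite hodge_signSS; apply: integral_antiholomorphic => //; first by lia.
  exact: tens_bform_form hbeta.
move: stokes norm_alpha.
rewrite integral_beta (integral_antiholomorphic kmn' fdt (db_bform ht)).
rewrite (integral_antiholomorphic kmn ft ht) => stokes norm_alpha.
have m1 : m.+1%:R = m%:R + 1 :> R[i] by rewrite natr1.
have m2 : m.+2%:R = m%:R + 2%:R :> R[i] by rewrite -addn2 natrD.
have norm_adj : inner (adj t) (adj t) = (m%:R + 2%:R) ^+ 2 * inner beta beta.
  rewrite adE innerZl // innerZr // mulrA; congr (_ * _).
  by rewrite -m2 mulcJ_nat_i.
have := inner_ge0 Kpos hherm inner_pos alpha; rewrite norm_alpha => {norm_alpha}.
move: stokes; rewrite hodge_signS exprS mulN1r !factS !natrM m1 m2 => stokes.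
have n0 (i j : nat) : (i%:R + j.+1%:R : R[i]) != 0 by rewrite -natrD addnS pnatr_eq0.
rewrite (nakano_coef _ (hodge_sign_neq0 k) (fact_neq0 m) (n0 m 0%N) (n0 m 1%N) (i_neq0 R)
  _ _ (mul_ii R) stokes) ?signr_eq0 ?sqrr_sign //.
have := inner_ge0 Kpos hherm inner_pos beta; rewrite norm_adj.
move: (inner beta beta) (inner t t) (inner (db t) (db t)) => X3 X0 X2 h3 hh.
have h4 : 0 <= (m%:R + 2%:R) * X3 by rewrite mulr_ge0 // addr_ge0 ?ler0n.
rewrite -subr_ge0; apply: le_trans (addr_ge0 hh h4) _.
rewrite le_eqVlt; apply/orP; left; apply/eqP; ring.
Qed.

(** * Eigenvalues of the Laplacian and of the Dirac operator *)

(** The junk value of [adjoint] at a tensor without an adjoint is excluded by this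
   condition, under which [adjoint] is linear. *)
Let adjointable t := forall u, inner (db u) t = inner u (adj t).

Let adjointable0 : adjointable 0 /\ adj 0 = 0.
Proof.
have e : adj 0 = 0.
  by apply: (adjoint_unique Kpos hherm inner_pos) => s; rewrite !inner0r.
by split=> // u; rewrite e !inner0r.
Qed.

Let adjD s t : adjointable s -> adjointable t ->
  adjointable (s + t) /\ adj (s + t) = adj s + adj t.
Proof.
move=> hs ht; have e u : inner (db u) (s + t) = inner u (adj s + adj t).
  by rewrite !innerDr // hs ht.
have e' := adjoint_unique Kpos hherm inner_pos e.
by split=> // u; rewrite e e'.
Qed.

Let adjZ c t : adjointable t ->
  adjointable (scal c *: t) /\ adj (scal c *: t) = scal c *: adj t.
Proof.
move=> ht; have e u : inner (db u) (scal c *: t) = inner u (scal c *: adj t).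
  by rewrite !innerZr // ht.
have e' := adjoint_unique Kpos hherm inner_pos e.
by split=> // u; rewrite e e'.
Qed.

Let Tb_adjointable k t : Tb 0 k t -> adjointable t.
Proof. by move=> ht u; apply: inner_adjoint ht. Qed.

Local Notation anti := (antiholomorphic_forms K (F := F)).
Local Notation lap := (laplacian K h f dbarF).
Local Notation dir := (dirac K h f dbarF).

Let anti_Tb k t : Tb 0 k t -> anti t.
Proof. by apply: tens_subS => w hw; exists k. Qed.

Let anti_ind (P : T -> Prop) : P 0 -> (forall s t, P s -> P t -> P (s + t)) ->
  (forall k t, Tb 0 k t -> P t) -> forall t, anti t -> P t.
Proof.
move=> P0 PD PT; apply: tens_sub_ind => // w x [k hw].
by apply: (PT k); apply: tens_sub_tens.
Qed.

Let anti_adj t : anti t -> [/\ adjointable t, anti (adj t) & anti (db t)].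
Proof.
move: t; apply: anti_ind => [|s t [s1 s2 s3] [t1 t2 t3]|k t ht].
- have [a0 ->] := adjointable0; rewrite db0; split=> //; exact: tens_sub0.
- have [a e] := adjD s1 t1; rewrite e dbD; split=> //; exact: tens_subD.
split; first exact: Tb_adjointable ht.
  exact: anti_Tb (adj_bform ht).1.
exact: anti_Tb (db_bform ht).
Qed.

Let dirD s t : anti s -> anti t -> dir (s + t) = dir s + dir t.
Proof.
move=> /anti_adj [hs _ _] /anti_adj [ht _ _].
by rewrite /dirac dbD (adjD hs ht).2 addrACA.
Qed.

Let dirZ c t : anti t -> dir (scal c *: t) = scal c *: dir t.
Proof.
by move=> /anti_adj [ht _ _]; rewrite /dirac dbZ (adjZ c ht).2 scalerDr.
Qed.

Let anti_dir t : anti t -> anti (dir t).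
Proof. by move=> /anti_adj [_ h1 h2]; apply: tens_subD. Qed.

(** Dual to the flatness of the holomorphic structure. *)
Let adjadj k t : Tb 0 k t -> adj (adj t) = 0.
Proof.
move=> ht; apply: (adjoint_unique Kpos hherm inner_pos) => s.
by rewrite -(inner_adjoint _ ht) dbdb inner0l // inner0r.
Qed.

Let lapE k t : Tb 0 k t -> lap t = db (adj t) + adj (db t).
Proof.
move=> ht; rewrite /laplacian dirD; [|exact: anti_Tb (db_bform ht)|exact: anti_Tb (adj_bform ht).1].
by rewrite /dirac dbdb (adjadj ht) add0r addr0 addrC.
Qed.

Let lap_Tb k t : Tb 0 k t -> Tb 0 k (lap t).
Proof.
move=> ht; rewrite (lapE ht); apply: tens_subD.
  case: k ht => [|k] ht; last exact: db_bform (adj_bform ht).1.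
  by rewrite (adj_bform ht).2 // db0; apply: tens_sub0.
exact: (adj_bform (db_bform ht)).1.
Qed.

Let scal_Tb c p q t : Tb p q t -> Tb p q (scal c *: t).
Proof. by apply: tens_sub_scale => w hw; rewrite mulr_algl; apply: subspaceZ. Qed.

Lemma inner_lap k t : Tb 0 k t ->
  inner (lap t) t = inner (db t) (db t) + inner (adj t) (adj t).
Proof.
move=> ht; rewrite (lapE ht) innerDl // addrC (inner_adjoint _ ht); congr (_ + _).
rewrite (inner_sym Kpos hherm inner_pos) -(inner_adjoint _ (db_bform ht)).
by rewrite -(inner_sym Kpos hherm inner_pos).
Qed.

Lemma laplacian_gap_lt_n k t lambda : (k < n)%N -> Tb 0 k t -> t != 0 -> lap t = scal lambda *: t ->
  theta%:C <= lambda.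
Proof.
move=> kn ht t0 e; have kmn : (k + (n - k.+1).+1)%N = n by lia.
have t_gt0 := inner_pos t0.
have := akizuki_nakano kmn ht; rewrite -(inner_lap ht) e innerZl // ler_pM2r //.
apply: le_trans; rewrite -[leLHS]mulr1 ler_wpM2l ?ler1n //.
by rewrite ler0c ltW.
Qed.

(** In top degree the antiholomorphic differential vanishes, and its adjoint carries
    the eigenvector to one in degree [n - 1]. *)
Lemma laplacian_gap_homogeneous k t lambda : Tb 0 k t -> t != 0 -> lambda != 0 ->
  lap t = scal lambda *: t -> theta%:C <= lambda.
Proof.
move=> ht t0 l0 e; case: (ltngtP k n) => kn; first exact: laplacian_gap_lt_n kn ht t0 e.
  by case/eqP: t0; apply: (tens_bform_gt_eq0 ht); rewrite kn orbT.
have db_t : db t = 0 by apply: (tens_bform_gt_eq0 (db_bform ht)); rewrite kn ltnSn orbT.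
have lt0 : lap t != 0.
  apply: contraNneq t0 => lt0; move: e; rewrite lt0 => /(congr1 (fun u => scal lambda^-1 *: u)).
  by rewrite scaler0 scalerA mulr_algl scalerA mulVf // scale1r scale1r => <-.
have lE : lap t = db (adj t) by rewrite (lapE ht) db_t adjointable0.2 addr0.
have u0 : adj t != 0 by apply: contraNneq lt0 => u0; rewrite lE u0 db0.
have k0 : (0 < k)%N by rewrite lt0n; apply: contraNneq u0 => k0; apply/eqP/(adj_bform ht).2.
have hu := (adj_bform ht).1.
have : (k.-1 < n)%N by lia.
move/laplacian_gap_lt_n; apply; [exact: hu|exact: u0|].
rewrite (lapE hu) (adjadj ht) db0 add0r -lE e.
exact: (adjZ lambda (Tb_adjointable ht)).2.
Qed.

Lemma anti_degree_decomposition t : anti t -> exists2 u : nat -> T,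
  forall k, Tb 0 k (u k) & t = \sum_(k < n.+1) u k.
Proof.
move: t; apply: anti_ind => [|s t [u hu ->] [v hv ->]|k t ht].
- by exists (fun=> 0); rewrite ?big1 // => k; apply: tens_sub0.
- by exists (fun k => u k + v k); rewrite ?big_split // => k; apply: tens_subD.
exists (fun l => if l == k then t else 0).
  by move=> l; case: eqP => [->//|_]; apply: tens_sub0.
case: (ltnP k n.+1) => kn; last first.
  by rewrite (tens_bform_gt_eq0 ht) ?kn ?orbT // big1 // => i _; rewrite if_same.
rewrite (bigD1 (Ordinal kn)) //= eqxx big1 ?addr0 // => i.
by rewrite -val_eqE /= => /negPf->.
Qed.

Let lapD s t : anti s -> anti t -> lap (s + t) = lap s + lap t.
Proof. by move=> hs ht; rewrite /laplacian dirD // dirD //; apply: anti_dir. Qed.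

Let lap0 : lap 0 = 0.
Proof. by rewrite /laplacian /dirac db0 adjointable0.2 addr0 db0 adjointable0.2 addr0. Qed.

(** Pair the sum with each of its terms: different bidegrees are orthogonal. *)
Let Tb_sum_eq0 (y : nat -> T) : (forall k, Tb 0 k (y k)) -> \sum_(k < n.+1) y k = 0 ->
  forall k, (k < n.+1)%N -> y k = 0.
Proof.
move=> hy y0 k kn; apply: (inner_eq0 inner_pos).
have := inner0l Kpos hherm f (y k); rewrite -y0.
rewrite (big_morph (fun s => inner s (y k)) (id1 := 0) (op1 := +%R)); first last.
- exact: inner0l.
- by move=> s t; apply: innerDl.
rewrite (bigD1 (Ordinal kn)) //= big1 ?addr0 // => i ik.
apply: (inner_neq_bidegree Kpos hherm f _ _ (hy i) (hy k)) => //.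
Qed.

Lemma laplacian_gap lambda : lambda != 0 -> eigenvalue_on anti lap lambda ->
  theta%:C <= lambda.
Proof.
move=> l0 [t [ht t0 e]]; rewrite /eigenspace /= in e.
have [u hu tE] := anti_degree_decomposition ht.
have e0 : \sum_(k < n.+1) (lap (u k) - scal lambda *: u k) = 0.
  rewrite sumrB -scaler_sumr -tE -e tE.
  suff [_ ->] : anti (\sum_(k < n.+1) u k) /\
      lap (\sum_(k < n.+1) u k) = \sum_(k < n.+1) lap (u k) by rewrite subrr.
  apply: (big_rec2 (fun a b => anti a /\ lap a = b)).
    by rewrite lap0; split=> //; apply: tens_sub0.
  move=> i a b _ [ha <-]; have hi := anti_Tb (hu i).
  by rewrite lapD //; split=> //; apply: tens_subD.
have ek := Tb_sum_eq0 (y := fun k => lap (u k) - scal lambda *: u k) _ e0.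
case: (pselect (exists2 k, (k < n.+1)%N & u k != 0)) => [[k kn uk0]|nu].
  apply: (laplacian_gap_homogeneous (hu k) uk0 l0).
  apply/eqP; rewrite -subr_eq0; apply/eqP/ek => // i.
  apply: tens_subD; first exact: lap_Tb.
  rewrite -scaleN1r; apply: tens_sub_scale (scal_Tb lambda (hu i)) => w hw.
  by rewrite mulN1r; apply: subspaceN.
case/eqP: t0; rewrite tE big1 // => -[k kn] _ /=.
by apply: contra_notP nu => /eqP uk; exists k.
Qed.

Lemma dirac_gap mu : mu != 0 -> eigenvalue_on anti dir mu -> (Num.sqrt theta)%:C <= `|mu|.
Proof.
move=> m0 [t [ht t0 e]]; rewrite /eigenspace /= in e.
have : theta%:C <= mu ^+ 2.
  apply: laplacian_gap; first by rewrite expf_neq0.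
  exists t; split=> //; rewrite /eigenspace /= /laplacian e dirZ // e scalerA.
  by rewrite mulr_algl scalerA expr2.
move=> hmu; rewrite -(ler_pXn2r (n := 2)) // ?nnegrE ?normr_ge0 ?ler0c ?sqrtr_ge0 //.
rewrite -normrX ger0_norm; last by apply: le_trans hmu; rewrite ler0c ltW.
by rewrite -rmorphXn /= sqr_sqrtr // ltW.
Qed.

End SpectralGap.

Theorem theorem3p4 (R : realType) (B : starAlgebra R) (Om : starCalculus B)
    (n : nat) (K : kahlerStructure Om n) (f : {scalar B})
    (F : lmodType B) (h : F -> F -> B)
    (dbarF nabla : F -> tensor (incl Om) F) (theta : R) :
  positive_definite K ->
  state f ->
  closed_integral K f ->
  hermitian_pairing h ->
  holomorphic K dbarF ->
  chern K h dbarF nabla ->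
  0 < theta ->
  (forall x : F, extend n (dif Om) nabla (nabla x)
     = tens (incl Om) ((theta%:C * 'i) *: kappa K) x) ->
  (forall t : tensor (incl Om) F, t != 0 -> 0 < inner K h f t t) ->
  diagonalisable (dirac K h f dbarF) ->
  (forall lambda : R[i], lambda != 0 ->
     eigenvalue_on (antiholomorphic_forms K (F := F))
       (laplacian K h f dbarF) lambda ->
     theta%:C <= lambda)
  /\
  (forall mu : R[i], mu != 0 ->
     eigenvalue_on (antiholomorphic_forms K (F := F))
       (dirac K h f dbarF) mu ->
     (Num.sqrt theta)%:C <= `|mu|).
Proof.
move=> Kpos _ fclosed hherm holo hchern theta_gt0 curv inner_pos _; split=> c c0.
  exact: (laplacian_gap Kpos fclosed hherm holo hchern theta_gt0 curv inner_pos c0).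
exact: (dirac_gap Kpos fclosed hherm holo hchern theta_gt0 curv inner_pos c0).
Qed.
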